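(* Let $w\in\mathbb{T}$ and $0<r<2$, and let $D_r(w)=\{z\in\mathbb{C}:|z-w|<r\}$. Let $P_n(z)=\sum_{k=0}^n A_{k,n}z^k$, $n\in\mathbb{N}$, be a sequence of random polynomials, where the $A_{k,n}$ are complex valued random variables (not necessarily independent nor identically distributed) such that, for a fixed $t>0$, $$\sup\{\mathbb{E}[|A_{k,n}|^t] : k=0,\ldots,n,\ n\in\mathbb{N}\}<\infty$$ and $$\inf\{\mathbb{E}[\log|A_{k,n}|] : k\in\{0,n\},\ n\in\mathbb{N}\}>-\infty.$$ Then the expected number of zeros of $P_n$ in $D_r(w)$ satisfies $$\mathbb{E}[n\tau_n(D_r(w))]=\frac{2\arcsin(r/2)}{\pi}\,n+O\left(\sqrt{n\log n}\right)\quad\text{as } n\to\infty.$$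
   Context: $\mathbb{T}=\{z\in\mathbb{C}:|z|=1\}$ is the unit circumference. For a polynomial $P_n$ of degree $n$ with complex zeros $Z_1,\ldots,Z_n$ (listed with multiplicity), the zero counting measure is $\tau_n=\frac1n\sum_{k=1}^n\delta_{Z_k}$, so $n\tau_n(D)$ is the number of zeros of $P_n$ in $D$. (The hypotheses imply $A_{0,n}A_{n,n}\ne0$ almost surely.) *)

(* Defs.v *)
From HB Require Import structures.
From mathcomp Require Import all_boot all_order all_algebra.
From mathcomp Require Import all_classical all_reals all_analysis.
From mathcomp Require Import complex.

Set Implicit Arguments.
Unset Strict Implicit.
Unset Printing Implicit Defensive.

Import Order.TTheory GRing.Theory Num.Theory.
Import numFieldNormedType.Exports.

Local Open Scope classical_set_scope.
Local Open Scope ring_scope.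

(* [Normc.normc] is the modulus of a complex number as an element of [R]; the
   generic norm of [R[i]] takes its values in [R[i]]. *)
Definition cmod (R : realType) (z : R[i]) : R := Normc.normc z.

Definition unit_circle (R : realType) : set R[i] := [set z | cmod z = 1].

Definition disc (R : realType) (w : R[i]) (r : R) : set R[i] :=
  [set z | cmod (z - w) < r].

(* Measurability for the Borel sets of [R[i]], identified with the plane. *)
Definition complex_random_variable d (T : measurableType d) (R : realType)
    (X : T -> R[i]) : Prop :=
  measurable_fun [set: T] (fun x => complex.Re (X x)) /\
  measurable_fun [set: T] (fun x => complex.Im (X x)).

(* The zeros of [p], each repeated according to its multiplicity. Every
   sequence satisfies the factorization of [0], whence the case split. *)
Definition zeros (R : realType) (p : {poly R[i]}) : seq R[i] :=
  if p == 0 then [::] else sval (closed_field_poly_normal p).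

(* The normalization is [n] itself rather than the number of zeros of [p]: the
   two agree as soon as [p] has degree exactly [n]. *)
Definition zero_counting (R : realType) (n : nat) (p : {poly R[i]})
    (D : set R[i]) : R :=
  n%:R^-1 * \sum_(z <- zeros p) \1_D z.

Definition random_poly (T : Type) (R : realType) (A : nat -> nat -> T -> R[i])
    (n : nat) (x : T) : {poly R[i]} :=
  \poly_(k < n.+1) A k n x.

(* Main.v *)
Require Import Defs.
From HB Require Import structures.
From mathcomp Require Import all_boot all_order all_algebra.
From mathcomp Require Import all_classical all_reals all_analysis.
From mathcomp Require Import complex.
From mathcomp Require Import ring lra zify measurable_realfun.

Set Implicit Arguments.
Unset Strict Implicit.
Unset Printing Implicit Defensive.

Import Order.TTheory GRing.Theory Num.Theory.
Import numFieldNormedType.Exports.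

Local Open Scope classical_set_scope.
Local Open Scope ring_scope.

(** Write N for the number of zeros of P_n in the disc, Z_1, ..., Z_n for the
zeros, zeta_j = Z_j / |Z_j|, b = 2 asin (r / 2) for the half-opening of the arc
that the disc cuts out of the unit circle, and
H = ln (sum of |A_k|) - (ln |A_0| + ln |A_n|) / 2 + ln (n + 1).
The proof is a deterministic discrepancy estimate, linear in H,
  |N - (b / pi) n| <= K (n d + H / d)   for every d in ]0, 1/2],
with K depending on b only ([disc_count]), followed by taking expectations.
The moment hypotheses give E H = O (log n), and d of order sqrt (log n / n)
balances the two terms.

The deterministic estimate is a variant of the Erdos-Turan theorem.

- By Schur's inequality |x - zeta|^2 |Z| <= |x - Z|^2 for |x| = 1, the
  polynomial Q (y) = prod (1 - y zeta_j) is bounded by e^H on the closed unit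
  disc ([angular_product_le]).  As log Q is holomorphic in the disc, vanishes at
  0 and has real part at most H, its k-th Taylor coefficient, which is the power
  sum of the zeta_j^k divided by -k, is at most 2 H in modulus
  ([power_sum_le]).  Integrals over circles are replaced by averages over roots
  of unity, which are exact on trigonometric polynomials of degree less than the
  number of roots.

- The indicator of an arc is an affine combination of two values of the
  sawtooth arg (1 - x) at unimodular x ([arc_indicator]).  Inside the disc, sums
  of arg (1 - u zeta_j) are controlled by the power sums, at the cost of a
  factor 1 / (1 - |u|) ([sum_argsub1_le]).  On a unit vector x, replacing the
  sawtooth by 2 arg (1 - (1 - d) x) - arg (1 - (1 - 2 d) x) costs
  O (d^2 / |1 - (1 - d) x|^2) ([sawtooth_smoothing]), that is, d times a Poisson
  kernel.  The combination of two radii matters: a single radius leaves an error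
  with the slower decay d / |1 - x|, hence a superfluous logarithm.  Sums of
  Poisson kernels are again controlled by the power sums ([sum_poisson_le]).

- Replacing Z_j by zeta_j in the indicator of the disc is harmless if
  | |Z_j| - 1 | <= d, except near the two endpoints of the arc, where the Poisson
  kernels absorb the error ([near_circle_indicator]).  The other zeros are few,
  because the sum of | ln |Z_j| | is at most 2 H by Jensen's inequality for the
  Mahler measure ([sum_ln_radius_le]).

As a function of the sample point, N enters the integral only through these
bounds: the integral of a nonnegative function is a supremum over the simple
functions below it, hence monotone whether or not the function is measurable, and
N lies between two measurable functions with close integrals ([integral_within]). *)

(** * The modulus of complex numbers *)

Lemma cmodM {R : realType} : {morph @cmod R : x y / x * y}.
Proof. exact: Normc.normcM. Qed.

Lemma cmod0 {R : realType} : cmod (0 : R[i]) = 0.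
Proof. exact: Normc.normc0. Qed.

Lemma cmod1 {R : realType} : cmod (1 : R[i]) = 1.
Proof. exact: Normc.normc1. Qed.

Lemma cmodV {R : realType} (z : R[i]) : cmod z^-1 = (cmod z)^-1.
Proof. exact: Normc.normcV. Qed.

Lemma cmodN {R : realType} (z : R[i]) : cmod (- z) = cmod z.
Proof. exact: normcN. Qed.

Lemma cmodD {R : realType} (x y : R[i]) : cmod (x + y) <= cmod x + cmod y.
Proof. exact: le_normcD. Qed.

Lemma cmod_sqr {R : realType} (z : R[i]) :
  cmod z ^+ 2 = complex.Re z ^+ 2 + complex.Im z ^+ 2.
Proof. by case: z => a b; rewrite /cmod /= sqr_sqrtr// addr_ge0// sqr_ge0. Qed.

Lemma cmod_ge0 {R : realType} (z : R[i]) : 0 <= cmod z.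
Proof. by case: z => a b; rewrite /cmod /= sqrtr_ge0. Qed.

Lemma cmod_eq0 {R : realType} (z : R[i]) : (cmod z == 0) = (z == 0).
Proof.
by apply/eqP/eqP => [|->]; [exact: Normc.eq0_normc | exact: cmod0].
Qed.

Lemma cmod_gt0 {R : realType} (z : R[i]) : (0 < cmod z) = (z != 0).
Proof. by rewrite lt_def cmod_ge0 andbT cmod_eq0. Qed.

Lemma cmodX {R : realType} (z : R[i]) n : cmod (z ^+ n) = cmod z ^+ n.
Proof. by elim: n => [|n ih]; rewrite ?expr0 ?cmod1// !exprS cmodM ih. Qed.

Lemma cmod_real {R : realType} (x : R) : cmod (x%:C)%C = `|x|.
Proof. by rewrite /cmod /= expr0n/= addr0 sqrtr_sqr. Qed.

Lemma cmod_nat {R : realType} n : cmod (n%:R : R[i]) = n%:R.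
Proof.
by rewrite -(rmorph_nat (real_complex R)) cmod_real ger0_norm.
Qed.

Lemma cmodJ {R : realType} (z : R[i]) : cmod (z^*)%C = cmod z.
Proof. by case: z => a b; rewrite /cmod /= sqrrN. Qed.

Lemma cmod_prod {R : realType} (I : Type) (s : seq I) (F : I -> R[i]) :
  cmod (\prod_(i <- s) F i) = \prod_(i <- s) cmod (F i).
Proof. by apply: (big_morph _ cmodM cmod1). Qed.

Lemma cmod_sum {R : realType} (I : Type) (s : seq I) (F : I -> R[i]) :
  cmod (\sum_(i <- s) F i) <= \sum_(i <- s) cmod (F i).
Proof.
elim/big_rec2 : _ => [|i x y _ xy]; first by rewrite cmod0.
by rewrite (le_trans (cmodD _ _))// lerD2l.
Qed.

Lemma normRe_le_cmod {R : realType} (z : R[i]) : `|complex.Re z| <= cmod z.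
Proof.
rewrite -(ler_pXn2r (n := 2))// ?nnegrE ?cmod_ge0//.
by rewrite cmod_sqr real_normK ?num_real// lerDl sqr_ge0.
Qed.

Lemma normIm_le_cmod {R : realType} (z : R[i]) : `|complex.Im z| <= cmod z.
Proof.
rewrite -(ler_pXn2r (n := 2))// ?nnegrE ?cmod_ge0//.
by rewrite cmod_sqr (real_normK (num_real _)) lerDr sqr_ge0.
Qed.

Lemma ReD {R : realType} : {morph @complex.Re R : x y / x + y}.
Proof. by case=> ? ? []. Qed.

Lemma ImD {R : realType} : {morph @complex.Im R : x y / x + y}.
Proof. by case=> ? ? []. Qed.

Lemma Re_sum {R : realType} (I : Type) (s : seq I) (F : I -> R[i]) :
  complex.Re (\sum_(i <- s) F i) = \sum_(i <- s) complex.Re (F i).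
Proof. exact: (big_morph _ ReD). Qed.

Lemma Im_sum {R : realType} (I : Type) (s : seq I) (F : I -> R[i]) :
  complex.Im (\sum_(i <- s) F i) = \sum_(i <- s) complex.Im (F i).
Proof. exact: (big_morph _ ImD). Qed.

Lemma ReN {R : realType} (z : R[i]) : complex.Re (- z) = - complex.Re z.
Proof. by case: z. Qed.

Lemma Re_scale {R : realType} (x : R) (z : R[i]) :
  complex.Re ((x%:C)%C * z) = x * complex.Re z.
Proof. by case: z => a b /=; rewrite mul0r subr0. Qed.

Lemma Im_scale {R : realType} (x : R) (z : R[i]) :
  complex.Im ((x%:C)%C * z) = x * complex.Im z.
Proof. by case: z => a b /=; rewrite mul0r addr0. Qed.

Lemma mulJ_cmod1 {R : realType} (z : R[i]) : cmod z = 1 -> z * (z^*)%C = 1.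
Proof.
move=> z1; have := cmod_sqr z; rewrite z1 expr1n.
case: z {z1} => a b /= h; apply/eqP; rewrite eq_complex /=; apply/andP; split.
  by rewrite mulrN opprK -!expr2 -h.
by rewrite mulrN mulrC addNr.
Qed.

(** * Roots of unity and coefficients of polynomials *)

Definition cis {R : realType} (x : R) : R[i] := Complex (cos x) (sin x).

Definition root_cis {R : realType} (N : nat) : R[i] :=
  cis (pi *+ 2 / N%:R).

Lemma expr_cis {R : realType} (x : R) n :
  cis x ^+ n = cis (x *+ n).
Proof.
elim: n => [|n ih]; first by rewrite expr0 /cis !mulr0n cos0 sin0.
rewrite exprS ih mulrS /cis cosD sinD; congr Complex.
by rewrite addrC [cos x * _]mulrC [sin x * _]mulrC.
Qed.

Lemma cmod_cis {R : realType} (x : R) : cmod (cis x) = 1.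
Proof. by rewrite /cmod/= cos2Dsin2 sqrtr1. Qed.

Lemma cmod_root_cis {R : realType} N : cmod (@root_cis R N) = 1.
Proof. exact: cmod_cis. Qed.

Lemma expr_root_cis {R : realType} N : (0 < N)%N -> @root_cis R N ^+ N = 1.
Proof.
move=> N0; rewrite expr_cis /cis -[X in cos X]mulr_natr -[X in sin X]mulr_natr divfK.
  by rewrite cos2pi sin2pi.
by rewrite pnatr_eq0 -lt0n.
Qed.

Lemma cos_lt1 {R : realType} (x : R) : 0 < x < pi *+ 2 -> cos x != 1.
Proof.
move=> /andP[x0 x2].
have -> : cos x = 1 - sin (x / 2) ^+ 2 *+ 2.
  rewrite {1}(_ : x = (x / 2) *+ 2) ?cos_mulr2n; last by rewrite -mulr_natr divfK.
  by rewrite cos2sin2; ring.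
have s0 : 0 < sin (x / 2).
  apply: sin_gt0_pi; rewrite divr_gt0//= ltr_pdivrMr//.
  by rewrite mulr_natr.
have := exprn_gt0 2 s0; move=> h; apply/eqP; lra.
Qed.

Lemma root_cis_neq1 {R : realType} N m : (0 < m < N)%N -> @root_cis R N ^+ m != 1.
Proof.
move=> /andP[m0 mN]; rewrite expr_cis.
have N0 : 0 < N%:R :> R by rewrite ltr0n (leq_trans _ mN).
have h : cos (pi *+ 2 / N%:R *+ m) != 1 :> R.
  apply: cos_lt1; have p0 := @pi_gt0 R.
  apply/andP; split.
    by rewrite mulrn_wgt0// divr_gt0// mulrn_wgt0.
  rewrite -[X in X < _]mulr_natr mulrAC ltr_pdivrMr//.
  by rewrite ltr_pM2l ?ltr_nat// mulrn_wgt0.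
by apply: contra h => /eqP[-> _].
Qed.

Lemma sum_root_cis_eq0 {R : realType} N m : (0 < m < N)%N ->
  \sum_(l < N) (@root_cis R N ^+ m) ^+ l = 0.
Proof.
move=> mN; have N0 : (0 < N)%N by case: N mN => //; rewrite ltn0 andbF.
have := subrX1 (@root_cis R N ^+ m) N.
rewrite -exprM mulnC exprM expr_root_cis// expr1n subrr => /esym/eqP.
rewrite mulf_eq0 subr_eq0 (negbTE (root_cis_neq1 mN))/=.
by move=> /eqP.
Qed.

Lemma sum_root_cisV_eq0 {R : realType} N m : (0 < m < N)%N ->
  \sum_(l < N) ((@root_cis R N)^-1 ^+ m) ^+ l = 0.
Proof.
move=> mN; have N0 : (0 < N)%N by case: N mN => //; rewrite ltn0 andbF.
have := subrX1 ((@root_cis R N)^-1 ^+ m) N.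
have w1 : (@root_cis R N)^-1 ^+ N = 1 by rewrite exprVn expr_root_cis// invr1.
rewrite -exprM mulnC exprM w1 expr1n subrr => /esym/eqP.
rewrite mulf_eq0 subr_eq0 exprVn invr_eq1 (negbTE (root_cis_neq1 mN))/=.
by rewrite -exprVn => /eqP.
Qed.

(** Discrete Fourier inversion: averaging over N-th roots of unity isolates one
coefficient exactly as soon as N exceeds the degree. *)
Lemma coef_root_cis {R : realType} (p : {poly R[i]}) N k :
  (size p <= N)%N -> (k < N)%N ->
  N%:R * p`_k = \sum_(l < N) p.[root_cis N ^+ l] * root_cis N ^- (l * k).
Proof.
move=> pN kN; pose w := @root_cis R N.
have w0 : w != 0 by rewrite -cmod_eq0 cmod_root_cis oner_eq0.
under eq_bigr do rewrite (horner_coef_wide _ pN) mulr_suml.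
rewrite exchange_big/= (bigD1 (Ordinal kN))//= [X in _ + X]big1.
  rewrite addr0 (eq_bigr (fun=> p`_k)) ?sumr_const ?card_ord ?mulr_natl//.
  by move=> l _; rewrite -exprM mulfK// expf_neq0.
move=> i; rewrite -val_eqE/= => ik.
under eq_bigr do rewrite -mulrA; rewrite -mulr_sumr.
have [ki|ik'|e] := ltngtP k i; last by rewrite -e eqxx in ik.
  rewrite (eq_bigr (fun l : 'I_N => (w ^+ (i - k)) ^+ l)).
    rewrite sum_root_cis_eq0 ?mulr0// subn_gt0 ki/=.
    exact: leq_ltn_trans (leq_subr _ _) (ltn_ord i).
  move=> l _; rewrite -!exprM -[in LHS](subnK (ltnW ki)) mulnDr exprD mulfK//.
    by rewrite mulnC.
  by rewrite expf_neq0.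
rewrite (eq_bigr (fun l : 'I_N => (w^-1 ^+ (k - i)) ^+ l)).
  rewrite sum_root_cisV_eq0 ?mulr0// subn_gt0 ik'/=.
  exact: leq_ltn_trans (leq_subr _ _) kN.
move=> l _; rewrite -!exprM -[in LHS](subnK (ltnW ik')) mulnDr addnC exprD invfM.
by rewrite mulrA divff ?expf_neq0// mul1r exprVn mulnC.
Qed.

Lemma coef_le_circle {R : realType} (p : {poly R[i]}) (M : R) :
  (forall z, cmod z = 1 -> cmod p.[z] <= M) -> forall k, cmod p`_k <= M.
Proof.
move=> pM k.
have M0 : 0 <= M by rewrite (le_trans (cmod_ge0 _) (pM 1 cmod1)).
have [kp|pk] := ltnP k (size p); last by rewrite nth_default// cmod0.
pose N := size p; pose w := @root_cis R N.
have N0 : (0 < N)%N by rewrite (leq_trans _ kp).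
have : cmod (N%:R * p`_k) <= N%:R * M.
  rewrite (coef_root_cis (leqnn _) kp) (le_trans (cmod_sum _ _))//.
  rewrite (le_trans (y := \sum_(l < N) M))//; last first.
    by rewrite sumr_const card_ord mulr_natl.
  apply: ler_sum => l _; rewrite cmodM cmodV !cmodX cmod_root_cis expr1n invr1 mulr1.
  by rewrite pM// cmodX cmod_root_cis expr1n.
by rewrite cmodM cmod_nat ler_pM2l// ltr0n.
Qed.

(** A crude maximum principle. The factor [size p] contributes only a logarithm to
the final estimate, and it spares the compactness argument behind the sharp one. *)
Lemma horner_le_circle {R : realType} (p : {poly R[i]}) (M : R) z :
  (forall z, cmod z = 1 -> cmod p.[z] <= M) -> cmod z <= 1 ->
  cmod p.[z] <= (size p)%:R * M.
Proof.
move=> pM z1; rewrite horner_coef (le_trans (cmod_sum _ _))//.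
rewrite (le_trans (y := \sum_(l < size p) M))//; last first.
  by rewrite sumr_const card_ord mulr_natl.
apply: ler_sum => l _; rewrite cmodM cmodX.
rewrite (le_trans _ (coef_le_circle pM l))// ler_piMr ?cmod_ge0//.
by rewrite exprn_ile1 ?cmod_ge0.
Qed.

(** * Taylor expansion of the logarithm of 1 - x *)

(** Minus the principal argument of [1 - x] when [complex.Re x < 1]. On the unit
circle this is the sawtooth function, with its jump at [x = 1], where the
convention for division by zero gives the mean value 0. *)
Definition argsub1 {R : realType} (x : R[i]) : R :=
  atan (complex.Im x / (1 - complex.Re x)).

(** Along the ray through [x = a + ib], the derivative of [argsub1 (t x)] is the
imaginary part of [x / (1 - t x)]. *)
Lemma is_derive_atan_ray {R : realType} (a b t : R) : 0 < 1 - t * a ->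
  is_derive t 1 (fun t => atan (t * b / (1 - t * a)))
    (b / ((1 - t * a) ^+ 2 + (t * b) ^+ 2)).
Proof.
move=> h.
have dq : is_derive t 1 (fun t : R => t * b / (1 - t * a)) (b / (1 - t * a) ^+ 2).
  have dn : is_derive t 1 (fun t : R => t * b) b.
    have := @is_derive_poly R ('X * b%:P) t.
    rewrite derivM derivX derivC !hornerE.
    by under [horner _]funext do rewrite !hornerE.
  have dd : is_derive t 1 (fun t : R => 1 - t * a) (- a).
    have := @is_derive_poly R (1 - 'X * a%:P) t.
    rewrite derivB derivM derivX !derivC !hornerE.
    by under [horner _]funext do rewrite !hornerE.
  have di : is_derive t 1 (fun t : R => (1 - t * a)^-1) (a / (1 - t * a) ^+ 2).
    have := @is_deriveV R (fun t => 1 - t * a) t (- a) 1.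
    move=> /(_ (lt0r_neq0 h) dd).
    by move/is_derive_eq; apply; rewrite /= scalerN -scaleNr opprK /GRing.scale/= mulrC.
  have := @is_deriveM _ _ (fun t : R => t * b) (fun t : R => (1 - t * a)^-1) t 1 _ _ dn di.
  move/is_derive_eq; apply; rewrite /GRing.scale/=; field.
  by rewrite lt0r_neq0.
have da : is_derive (t * b / (1 - t * a)) 1 (@atan R)
    ((1 + (t * b / (1 - t * a)) ^+ 2)^-1).
  by apply: is_derive1_atan.
have := @is_derive1_comp _ (@atan R) (fun t => t * b / (1 - t * a)) t _ _ da dq.
move/is_derive_eq; apply; rewrite /GRing.scale/=; field.
by rewrite !lt0r_neq0//= ltr_wpDr ?exprn_gt0 ?sqr_ge0.
Qed.

(** Likewise the derivative of [ln |1 - t x|] is the opposite of the real part of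
[x / (1 - t x)]. *)
Lemma is_derive_ln_ray {R : realType} (a b t : R) :
  0 < (1 - t * a) ^+ 2 + (t * b) ^+ 2 ->
  is_derive t 1 (fun t => ln ((1 - t * a) ^+ 2 + (t * b) ^+ 2) / 2)
    ((t * b ^+ 2 - a * (1 - t * a)) / ((1 - t * a) ^+ 2 + (t * b) ^+ 2)).
Proof.
move=> h.
have dD : is_derive t 1 (fun t : R => (1 - t * a) ^+ 2 + (t * b) ^+ 2)
   (2 * (t * b ^+ 2 - a * (1 - t * a))).
  have := @is_derive_poly R ((1 - 'X * a%:P) ^+ 2 + ('X * b%:P) ^+ 2) t.
  under [horner _]funext do rewrite !hornerE.
  move/is_derive_eq; apply.
  rewrite -polyC1 !expr2 !(derivB, derivD, derivM, derivX, derivN, derivC, hornerE) /=; ring.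
have dl := is_derive1_ln h.
have := @is_derive1_comp _ (@ln R) _ t _ _ dl dD => dc.
have := @is_deriveM _ _ _ (cst (2^-1 : R)) t 1 _ _ dc (is_derive_cst _ _ _).
move/is_derive_eq; apply; rewrite /GRing.scale/=; field.
by rewrite lt0r_neq0.
Qed.

Lemma cmod_1B_ge {R : realType} (x : R[i]) : 1 - cmod x <= cmod (1 - x).
Proof.
rewrite lerBlDr -[leLHS]cmod1; rewrite -[X in cmod X <= _](subrK x).
exact: cmodD.
Qed.

(** Common to the real and imaginary parts of the logarithm, selected by the
unimodular factor [c]: after removing the Taylor polynomial, the derivative along
the ray is the tail [x (t x)^M / (1 - t x)] of a geometric series, so that the
mean value theorem bounds the remainder. *)
Lemma log_series_remainder {R : realType} (c x : R[i]) (F : R -> R) (M : nat) :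
  cmod x < 1 -> cmod c <= 1 -> F 0 = 0 ->
  (forall t : R, 0 <= t <= 1 ->
    is_derive t 1 F (complex.Re (c * (x / (1 - (t%:C)%C * x))))) ->
  `|F 1 - \sum_(k < M) complex.Re (c * x ^+ k.+1) / k.+1%:R|
    <= cmod x ^+ M.+1 / (1 - cmod x).
Proof.
move=> x1 c1 F0 dF.
pose p : {poly R} := \poly_(k < M.+1) (complex.Re (c * x ^+ k) / k%:R).
have p0 : p.[0] = 0.
  by rewrite horner_coef0 coef_poly/= invr0 mulr0.
have p1 : p.[1] = \sum_(k < M) complex.Re (c * x ^+ k.+1) / k.+1%:R.
  rewrite (@horner_coef_wide _ M.+1) ?size_poly// big_ord_recl -horner_coef0 p0.
  rewrite mul0r add0r; apply: eq_bigr => i _.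
  by rewrite expr1n mulr1 coef_poly ltnS ltn_ord.
have dp t : p^`().[t] = \sum_(k < M) complex.Re (c * x ^+ k.+1) * t ^+ k.
  rewrite (@horner_coef_wide _ M); last first.
    have [->|pn0] := eqVneq p 0; first by rewrite deriv0 size_poly0.
    by rewrite -ltnS (leq_trans (lt_size_deriv pn0))// size_poly.
  apply: eq_bigr => i _; rewrite coef_deriv coef_poly ltnS ltn_ord.
  by rewrite -[X in X * _ = _]mulr_natr divfK// pnatr_eq0.
have dg (t : R) : 0 <= t <= 1 -> is_derive t 1 (F - horner p)
    (complex.Re (c * (x / (1 - (t%:C)%C * x))) - p^`().[t]).
  by move=> /dF dFt; apply: is_deriveB.
have [t||t /itvP t01] := @MVT_segment R (F - horner p)
   (fun t => complex.Re (c * (x / (1 - (t%:C)%C * x))) - p^`().[t]) 0 1 ler01.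
- by move=> /itvP t01; apply: dg; rewrite !t01.
- apply: derivable_within_continuous => t /itvP t01; apply: ex_derive.
  by apply: dg; rewrite !t01.
have -> : (F - horner p) 1 - (F - horner p) 0 = F 1 - p.[1] - (F 0 - p.[0]) by [].
rewrite F0 p0 !subr0 mulr1 -p1 => ->.
set y := (t%:C)%C * x.
have yx : cmod y <= cmod x.
  by rewrite cmodM cmod_real ger0_norm ?t01// ler_piMl ?cmod_ge0 ?t01.
have hy : 0 < 1 - cmod x <= cmod (1 - y).
  rewrite subr_gt0 x1/=; apply: le_trans (cmod_1B_ge y).
  by rewrite lerB.
have y1 : 1 - y != 0.
  by rewrite -cmod_gt0; case/andP: hy => h /(lt_le_trans h).
have -> : complex.Re (c * (x / (1 - y))) - p^`().[t] =
    complex.Re (c * (x * y ^+ M / (1 - y))).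
  have -> : p^`().[t] = complex.Re (c * (x * \sum_(k < M) y ^+ k)).
    rewrite dp !mulr_sumr Re_sum; apply: eq_bigr => k _.
    rewrite /y exprMn -rmorphXn/= -[RHS](_ : complex.Re ((t ^+ k)%:C%C * (c * x ^+ k.+1)) = _).
      by rewrite Re_scale mulrC.
    by rewrite exprS; congr complex.Re; ring.
  rewrite -ReN -ReD; congr complex.Re.
  have -> : y ^+ M = 1 - (1 - y) * \sum_(k < M) y ^+ k.
    rewrite -[1 - y]opprB mulNr -subrX1 opprK; ring.
  by field.
rewrite (le_trans (normRe_le_cmod _))// !cmodM cmodV cmodX.
rewrite (le_trans (y := 1 * (cmod x * cmod x ^+ M / (1 - cmod x))))//; last first.
  by rewrite mul1r exprS.
case/andP: hy => hy0 hy1.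
rewrite ler_pM ?cmod_ge0// ?mulr_ge0 ?invr_ge0 ?exprn_ge0 ?cmod_ge0//.
rewrite ler_pM ?mulr_ge0 ?invr_ge0 ?exprn_ge0 ?cmod_ge0//.
  by rewrite ler_wpM2l ?cmod_ge0// lerXn2r ?nnegrE ?cmod_ge0.
by rewrite lef_pV2 ?posrE// (lt_le_trans hy0).
Qed.

Lemma ln_cmod {R : realType} (z : R[i]) :
  ln (cmod z) = ln (complex.Re z ^+ 2 + complex.Im z ^+ 2) / 2.
Proof.
have [->|z0] := eqVneq z 0.
  by rewrite cmod0 /= expr0n/= addr0 ln0// mul0r.
have cz : 0 < cmod z by rewrite cmod_gt0.
by rewrite -cmod_sqr lnXn// -[_ *+ 2]mulr_natr mulfK.
Qed.

Lemma ray_cmod_sqr {R : realType} (x : R[i]) (t : R) :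
  (1 - t * complex.Re x) ^+ 2 + (t * complex.Im x) ^+ 2
  = cmod (1 - (t%:C)%C * x) ^+ 2.
Proof. by case: x => a b; rewrite cmod_sqr /=; ring. Qed.

Lemma Re_invM {R : realType} (x z : R[i]) :
  complex.Re (x / z) = (complex.Re x * complex.Re z + complex.Im x * complex.Im z)
     / (complex.Re z ^+ 2 + complex.Im z ^+ 2).
Proof. by case: x z => a b [p q] /=; ring. Qed.

Lemma Im_invM {R : realType} (x z : R[i]) :
  complex.Im (x / z) = (complex.Im x * complex.Re z - complex.Re x * complex.Im z)
     / (complex.Re z ^+ 2 + complex.Im z ^+ 2).
Proof. by case: x z => a b [p q] /=; ring. Qed.

Lemma Re_lt1 {R : realType} (x : R[i]) (t : R) : cmod x < 1 -> 0 <= t <= 1 ->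
  0 < 1 - t * complex.Re x.
Proof.
move=> x1 /andP[t0 t1]; rewrite subr_gt0.
have h : complex.Re x < 1.
  by rewrite (le_lt_trans (ler_norm _))// (le_lt_trans (normRe_le_cmod _)).
have [->|tn1] := eqVneq t 1; first by rewrite mul1r.
have t1' : t < 1 by rewrite lt_neqAle tn1.
by nra.
Qed.

Lemma argsub1_series {R : realType} (x : R[i]) (M : nat) : cmod x < 1 ->
  `|argsub1 x - \sum_(k < M) complex.Im (x ^+ k.+1) / k.+1%:R|
    <= cmod x ^+ M.+1 / (1 - cmod x).
Proof.
move=> x1.
have ReNi (z : R[i]) : complex.Re (Complex 0 (-1) * z) = complex.Im z.
  by case: z => a b /=; ring.
have := @log_series_remainder R (Complex 0 (-1)) x
  (fun t => atan (t * complex.Im x / (1 - t * complex.Re x))) M x1.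
rewrite !mul1r; under eq_bigr do rewrite ReNi; apply.
- by rewrite /cmod/= expr0n/= add0r sqrrN expr1n sqrtr1.
- by rewrite !mul0r atan0.
move=> t t01; rewrite ReNi.
have := @is_derive_atan_ray R _ (complex.Im x) t (Re_lt1 x1 t01).
move/is_derive_eq; apply; rewrite Im_invM; case: (x) => a b /=.
congr (_ / _); ring.
Qed.

Lemma ln_cmod_series {R : realType} (x : R[i]) (M : nat) : cmod x < 1 ->
  `|ln (cmod (1 - x)) + \sum_(k < M) complex.Re (x ^+ k.+1) / k.+1%:R|
    <= cmod x ^+ M.+1 / (1 - cmod x).
Proof.
move=> x1.
pose F (t : R) := ln ((1 - t * complex.Re x) ^+ 2 + (t * complex.Im x) ^+ 2) / 2.
have F1 : F 1 = ln (cmod (1 - x)).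
  by rewrite /F ray_cmod_sqr cmod_sqr -ln_cmod (rmorph1 (real_complex R)) mul1r.
have := @log_series_remainder R (-1) x F M x1; rewrite F1.
under eq_bigr do rewrite mulN1r ReN mulNr.
rewrite sumrN opprK; apply.
- by rewrite cmodN cmod1.
- by rewrite /F !mul0r subr0 expr1n expr0n/= addr0 ln1 mul0r.
move=> t t01; rewrite mulN1r ReN.
have h : 0 < (1 - t * complex.Re x) ^+ 2 + (t * complex.Im x) ^+ 2.
  by rewrite ltr_wpDr ?sqr_ge0// exprn_gt0// Re_lt1.
have := is_derive_ln_ray h.
move/is_derive_eq; apply; rewrite Re_invM -[RHS]mulNr; case: (x) => a b /=.
congr (_ / _); ring.
Qed.

(** * Power sums of points of the unit circle *)

Lemma cmod_nonneg_real {R : realType} (x : R) : 0 <= x -> cmod (x%:C)%C = x.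
Proof. by move=> x0; rewrite cmod_real ger0_norm. Qed.

(** A coefficient of a nonnegative trigonometric polynomial is at most twice its
mean. Multiplication by [z ^+ M] makes the trigonometric polynomial a genuine one
of size at most [2 M + 1], whose coefficients are averages over roots of unity;
the middle one is the average of the modulus. *)
Lemma nonneg_trig_coef_le {R : realType} (a : R) (c : nat -> R[i]) (M : nat) :
  (forall z, cmod z = 1 ->
     0 <= a + \sum_(m < M) complex.Re (c m * z ^+ m.+1)) ->
  forall k, (k < M)%N -> cmod (c k) <= 2 * a.
Proof.
move=> G0 k kM.
pose p : {poly R[i]} := \sum_(m < M) (c m *: 'X^(M + m.+1) +
   ((c m)^*)%C *: 'X^(M - m.+1)) + ((2 * a)%:C)%C *: 'X^M.
have pE j : p`_j = \sum_(m < M) (c m * (j == M + m.+1)%N%:R +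
     ((c m)^*)%C * (j == M - m.+1)%N%:R) + ((2 * a)%:C)%C * (j == M)%:R.
  rewrite coefD coef_sum coefZ coefXn; congr (_ + _).
  by apply: eq_bigr => m _; rewrite coefD !coefZ !coefXn.
have pM : p`_M = ((2 * a)%:C)%C.
  rewrite pE eqxx mulr1 big1 ?add0r// => m _.
  rewrite (_ : M == M + m.+1 = false)%N; last by apply/negbTE; lia.
  rewrite (_ : M == M - m.+1 = false)%N; last by have := ltn_ord m; lia.
  by rewrite !mulr0 addr0.
have pk : p`_(M + k.+1) = c k.
  rewrite pE (_ : M + k.+1 == M = false)%N; last by apply/negbTE; lia.
  rewrite mulr0 addr0 (bigD1 (Ordinal kM))//= eqxx mulr1.
  rewrite (_ : M + k.+1 == M - k.+1 = false)%N; last by lia.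
  rewrite mulr0 addr0 big1 ?addr0// => m; rewrite -val_eqE/= => mk.
  rewrite (_ : M + k.+1 == M + m.+1 = false)%N; last by lia.
  rewrite (_ : M + k.+1 == M - m.+1 = false)%N; last by lia.
  by rewrite !mulr0 addr0.
pose N := (M + M).+1.
have sp : (size p <= N)%N.
  apply/leq_sizeP => j; rewrite /N => jN.
  rewrite pE (_ : j == M = false)%N; last by lia.
  rewrite mulr0 addr0 big1// => m _; have := ltn_ord m => mM.
  rewrite (_ : j == M + m.+1 = false)%N; last by lia.
  rewrite (_ : j == M - m.+1 = false)%N; last by lia.
  by rewrite !mulr0 addr0.
pose G z := a + \sum_(m < M) complex.Re (c m * z ^+ m.+1).
have pz z : cmod z = 1 -> p.[z] = ((2 * G z)%:C)%C * z ^+ M.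
  move=> z1; have z0 : z != 0 by rewrite -cmod_eq0 z1 oner_eq0.
  rewrite /p hornerD horner_sum hornerZ hornerXn.
  have -> : (2 * G z)%:C%C = \sum_(m < M) (2%:C%C *
      (complex.Re (c m * z ^+ m.+1))%:C%C) + (2 * a)%:C%C.
    rewrite -mulr_sumr -rmorph_sum -rmorphM -rmorphD /G; congr (_%:C%C); ring.
  rewrite [RHS]mulrDl; congr (_ + _); rewrite mulr_suml; apply: eq_bigr => m _.
  rewrite hornerD !hornerZ !hornerXn.
  have zM : z ^+ M = z ^+ (M - m.+1) * z ^+ m.+1 by rewrite -exprD subnK.
  have zMm : z ^+ (M + m.+1) = z ^+ (M - m.+1) * z ^+ m.+1 * z ^+ m.+1.
    by rewrite -zM exprD.
  have zV : (z^*)%C = z^-1 by rewrite -[LHS]mul1r -(divff z0) mulrAC mulJ_cmod1// mul1r.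
  rewrite zMm zM ReJ_add rmorphM rmorphXn/= zV exprVn.
  have -> : (2%:C)%C = 2%:R :> R[i] by rewrite (rmorph_nat (real_complex R) 2).
  have um : z ^+ m.+1 != 0 by rewrite expf_neq0.
  by field.
have w1 l : cmod (@root_cis R N ^+ l) = 1 by rewrite cmodX cmod_root_cis expr1n.
have w0 l : @root_cis R N ^+ l != 0 by rewrite -cmod_eq0 w1 oner_eq0.
have N0 : 0 < N%:R :> R by rewrite ltr0n.
have sumG : \sum_(l < N) 2 * G (root_cis N ^+ l) = N%:R * (2 * a).
  apply: (@complexI R); rewrite rmorphM/= -pM (rmorph_nat (real_complex R)).
  rewrite (coef_root_cis sp); last by rewrite /N; lia.
  rewrite rmorph_sum; apply: eq_bigr => l _ /=.
  by rewrite pz// -exprM mulfK.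
have : N%:R * cmod (c k) <= N%:R * (2 * a).
  rewrite -sumG -pk -cmod_nat -cmodM (coef_root_cis sp); last by rewrite /N; lia.
  rewrite (le_trans (cmod_sum _ _))//; apply: ler_sum => l _.
  rewrite cmodM pz// cmodM cmodV !w1 cmodX w1 expr1n invr1 !mulr1.
  by rewrite cmod_nonneg_real// mulr_ge0//; exact: G0.
by rewrite ler_pM2l.
Qed.

Lemma ln_prod {R : realType} (I : eqType) (s : seq I) (F : I -> R) :
  (forall i, i \in s -> 0 < F i) ->
  ln (\prod_(i <- s) F i) = \sum_(i <- s) ln (F i).
Proof.
move=> F0.
have : 0 < \prod_(i <- s) F i /\ ln (\prod_(i <- s) F i) = \sum_(i <- s) ln (F i).
  elim: s F0 => [|i s ih] F0; first by rewrite !big_nil ln1.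
  rewrite !big_cons.
  have [|p0 e] := ih; first by move=> j js; apply: F0; rewrite inE js orbT.
  have Fi : 0 < F i by apply: F0; rewrite mem_head.
  by rewrite lnM ?posrE// e mulr_gt0.
by case.
Qed.

(** Used to let the truncation order of a series tend to infinity. *)
Lemma le_of_pow_small {R : realType} (a b e q : R) : 0 <= q < 1 ->
  (forall M : nat, a <= b + e * q ^+ M) -> a <= b.
Proof.
move=> /andP[q0 q1] h.
have c1 : (fun M => b + e * q ^+ M) @ \oo --> b + e * 0.
  apply: cvgD; first exact: cvg_cst.
  by apply: cvgMr; apply: cvg_expr; rewrite ger0_norm.
rewrite mulr0 addr0 in c1.
rewrite -(cvg_lim _ c1)//; apply: limr_ge; first by apply/cvg_ex; exists b.
by near=> M; exact: h.
Unshelve. all: by end_near. Qed.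

(** The function [H - ln |prod (1 - z x)|] is nonnegative in the disc, and its
mean over a circle around 0 is [H]. By the Taylor expansion of the logarithm, on
the circle of radius [q] it is, up to a truncation error, [H] plus the real parts
of [q^k / k] times the k-th power sum times [z^k], so [nonneg_trig_coef_le]
applies. The truncation order then tends to infinity and [q] to 1. *)
Lemma power_sum_le {R : realType} (s : seq R[i]) (H : R) :
  (forall x, x \in s -> cmod x = 1) ->
  (forall z, cmod z < 1 -> cmod (\prod_(x <- s) (1 - z * x)) <= expR H) ->
  forall k, (0 < k)%N -> cmod (\sum_(x <- s) x ^+ k) <= 2 * k%:R * H.
Proof.
move=> s1 Q [//|k] _.
pose S m := \sum_(x <- s) x ^+ m.
rewrite -/(S k.+1).
have key (q : R) M : 0 < q < 1 -> (k < M)%N ->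
  cmod ((q ^+ k.+1 / k.+1%:R)%:C%C * S k.+1) <=
    2 * (H + (size s)%:R * (q ^+ M.+1 / (1 - q))).
  move=> /andP[q0 q1] kM.
  pose E := (size s)%:R * (q ^+ M.+1 / (1 - q)).
  apply: (@nonneg_trig_coef_le _ _ (fun m => (q ^+ m.+1 / m.+1%:R)%:C%C * S m.+1) M)
    => // z z1.
  pose y := q%:C%C * z.
  have xq x : x \in s -> cmod (y * x) = q.
    by move=> xs; rewrite !cmodM cmod_real z1 s1// !mulr1 gtr0_norm.
  have pos x : x \in s -> 0 < cmod (1 - y * x).
    move=> xs; apply: lt_le_trans (cmod_1B_ge _).
    by rewrite xq// subr_gt0.
  have lnQ : \sum_(x <- s) ln (cmod (1 - y * x)) <= H.
    rewrite -ln_prod// -cmod_prod -ler_expR lnK ?posrE.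
      by apply: Q; rewrite cmodM cmod_real z1 mulr1 gtr0_norm.
    rewrite cmod_prod big_seq; apply: prodr_gt0 => x xs; exact: pos.
  have tay x : x \in s ->
      - (q ^+ M.+1 / (1 - q)) <= ln (cmod (1 - y * x)) +
        \sum_(m < M) complex.Re ((y * x) ^+ m.+1) / m.+1%:R.
    move=> xs; have := @ln_cmod_series R (y * x) M.
    by rewrite xq// => /(_ q1); rewrite ler_norml => /andP[].
  have : \sum_(x <- s) - (q ^+ M.+1 / (1 - q)) <=
     \sum_(x <- s) (ln (cmod (1 - y * x)) +
        \sum_(m < M) complex.Re ((y * x) ^+ m.+1) / m.+1%:R).
    by rewrite !big_seq; apply: ler_sum => x; exact: tay.
  have -> : \sum_(x <- s) - (q ^+ M.+1 / (1 - q)) = - E.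
    by rewrite sumrN big_const_seq count_predT iter_addr_0 -mulr_natl.
  rewrite big_split/= exchange_big/=.
  have -> : \sum_(m < M) \sum_(x <- s) complex.Re ((y * x) ^+ m.+1) / m.+1%:R =
     \sum_(m < M) complex.Re ((q ^+ m.+1 / m.+1%:R)%:C%C * S m.+1 * z ^+ m.+1).
    apply: eq_bigr => m _; rewrite -mulrA Re_scale /S.
    rewrite -mulr_suml -Re_sum mulrAC; congr (_ / _).
    rewrite -Re_scale; congr complex.Re.
    rewrite mulr_suml mulr_sumr; apply: eq_bigr => x _.
    by rewrite /y !exprMn rmorphXn/=; ring.
  move=> h; rewrite -/E addrAC -lerBlDr sub0r (le_trans h)// lerD2r.
  exact: lnQ.
have H0 : forall q : R, 0 < q < 1 -> q ^+ k.+1 * cmod (S k.+1) <= 2 * k.+1%:R * H.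
  move=> q q01; have /andP[q0 q1] := q01.
  have q1' : 0 < 1 - q by rewrite subr_gt0.
  apply: (@le_of_pow_small _ _ _ (2 * k.+1%:R * (size s)%:R * q ^+ k.+2 / (1 - q)) q).
    by rewrite ltW.
  move=> M; have := key q (k.+1 + M)%N q01; rewrite ltn_addr// => /(_ isT).
  rewrite cmodM cmod_nonneg_real ?divr_ge0 ?exprn_ge0 ?(ltW q0)//.
  rewrite mulrAC ler_pdivrMr ?ltr0n// => /le_trans; apply.
  by rewrite -addSn exprD le_eqVlt; apply/orP; left; apply/eqP; field; rewrite lt0r_neq0.
have bern : forall (q : R) n, 0 <= q <= 1 -> 1 - n%:R * (1 - q) <= q ^+ n.
  move=> q n /andP[q0 q1]; elim: n => [|n ih]; first by rewrite mul0r subr0 expr0.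
  rewrite exprS -natr1 (le_trans _ (ler_wpM2l q0 ih))//.
  have n0 : 0 <= n%:R :> R by [].
  have := mulr_ge0 n0 (sqr_ge0 (1 - q)); lra.
(* Bernoulli's inequality lets [q] tend to 1 along [1 - (1 / 2) ^+ M.+1]. *)
apply: (@le_of_pow_small _ _ _ (k.+1%:R * cmod (S k.+1) / 2) (1 / 2)); first by lra.
move=> M; pose q : R := 1 - (1 / 2) ^+ M.+1.
have h0 : 0 < (1 / 2 : R) ^+ M.+1 by rewrite exprn_gt0//; lra.
have h1 : (1 / 2 : R) ^+ M.+1 < 1 by rewrite exprn_ilt1//; lra.
have q01 : 0 < q < 1 by rewrite /q; lra.
have q01' : 0 <= q <= 1 by rewrite /q; lra.
have := H0 q q01; have := ler_wpM2r (cmod_ge0 (S k.+1)) (bern q k.+1 q01').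
have -> : 1 - q = (1 / 2) ^+ M.+1 by rewrite /q; ring.
rewrite exprS; lra.
Qed.

(** * Sums of arguments and of Poisson kernels *)

Lemma geometric_le {R : realType} (q : R) M : 0 <= q < 1 ->
  \sum_(m < M) q ^+ m <= (1 - q)^-1.
Proof.
move=> /andP[q0 q1]; rewrite -[leRHS]mul1r ler_pdivlMr ?subr_gt0//.
rewrite mulrC -opprB mulNr -subrX1 opprB lerBlDr lerDl.
exact: exprn_ge0.
Qed.

Lemma arith_geometric_le {R : realType} (q : R) M : 0 <= q < 1 ->
  \sum_(m < M) m.+1%:R * q ^+ m <= ((1 - q) ^+ 2)^-1.
Proof.
move=> /andP[q0 q1]; rewrite -[leRHS]mul1r ler_pdivlMr ?exprn_gt0 ?subr_gt0//.
have -> : (\sum_(m < M) m.+1%:R * q ^+ m) * (1 - q) ^+ 2 =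
  1 - M.+1%:R * q ^+ M + M%:R * q ^+ M.+1.
  elim: M => [|M ih]; first by rewrite big_ord0 expr0; ring.
  by rewrite big_ord_recr/= mulrDl ih !exprS -!natr1; ring.
have : M%:R * q ^+ M.+1 <= M.+1%:R * q ^+ M.
  rewrite exprS ler_pM// ?mulr_ge0 ?exprn_ge0// ?ler_nat//.
  by rewrite ler_piMl ?exprn_ge0// ltW.
lra.
Qed.

(** Expanding the argument in powers of [u], the k-th term is at most
[|u|^k * 2 * H] by the bound on the power sums: a geometric series. *)
Lemma sum_argsub1_le {R : realType} (s : seq R[i]) (H : R) (u : R[i]) :
  (forall x, x \in s -> cmod x = 1) ->
  (forall k, (0 < k)%N -> cmod (\sum_(x <- s) x ^+ k) <= 2 * k%:R * H) ->
  0 <= H -> cmod u < 1 ->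
  `|\sum_(x <- s) argsub1 (u * x)| <= 2 * H / (1 - cmod u).
Proof.
move=> s1 SH H0 u1.
have q01 : 0 <= cmod u < 1 by rewrite cmod_ge0.
apply: (@le_of_pow_small _ _ _ ((size s)%:R * cmod u / (1 - cmod u)) (cmod u)) => // M.
pose T := \sum_(x <- s) \sum_(m < M) complex.Im ((u * x) ^+ m.+1) / m.+1%:R.
have hT : `|T| <= 2 * H / (1 - cmod u).
  rewrite /T exchange_big/= (le_trans (ler_norm_sum _ _ _))//.
  rewrite (le_trans (y := \sum_(m < M) 2 * H * cmod u ^+ m))//; last first.
    rewrite -mulr_sumr ler_wpM2l ?mulr_ge0//; exact: geometric_le.
  apply: ler_sum => m _; rewrite -mulr_suml -Im_sum normrM normfV.
  rewrite (ger0_norm (ler0n _ _)) ler_pdivrMr ?ltr0n//.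
  under eq_bigr do rewrite exprMn.
  rewrite -mulr_sumr (le_trans (normIm_le_cmod _))// cmodM cmodX exprS.
  have := SH m.+1 isT => hS.
  have h1 : cmod u * cmod u ^+ m <= cmod u ^+ m.
    by rewrite ler_piMl ?exprn_ge0 ?cmod_ge0// ltW.
  rewrite (le_trans (ler_pM _ _ h1 hS)) ?mulr_ge0 ?exprn_ge0 ?cmod_ge0//.
  by rewrite le_eqVlt; apply/orP; left; apply/eqP; ring.
have dT : `|\sum_(x <- s) argsub1 (u * x) - T| <=
    (size s)%:R * (cmod u ^+ M.+1 / (1 - cmod u)).
  rewrite /T -sumrB (le_trans (ler_norm_sum _ _ _))//.
  rewrite (le_trans (y := \sum_(x <- s) cmod u ^+ M.+1 / (1 - cmod u)))//; last first.
    by rewrite big_const_seq count_predT iter_addr_0 mulr_natl.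
  rewrite big_seq [leRHS]big_seq; apply: ler_sum => x xs.
  have ux : cmod (u * x) = cmod u by rewrite cmodM (s1 _ xs) mulr1.
  by have := @argsub1_series _ (u * x) M; rewrite ux; apply.
rewrite -[X in `|X|](subrK T) (le_trans (ler_normD _ _))// addrC lerD//.
rewrite (le_trans dT)// exprS le_eqVlt; apply/orP; left; apply/eqP; ring.
Qed.

(** The Poisson kernel at [u x] is 1 plus twice the real part of the sum of the
[(u x)^k]; the bound on the power sums leaves an arithmetico-geometric series. *)
Lemma sum_poisson_le {R : realType} (s : seq R[i]) (H : R) (u : R[i]) :
  (forall x, x \in s -> cmod x = 1) ->
  (forall k, (0 < k)%N -> cmod (\sum_(x <- s) x ^+ k) <= 2 * k%:R * H) ->
  0 <= H -> cmod u < 1 ->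
  \sum_(x <- s) (1 - cmod u ^+ 2) / cmod (1 - u * x) ^+ 2
    <= (size s)%:R + 4 * H / (1 - cmod u) ^+ 2.
Proof.
move=> s1 SH H0 u1.
have q01 : 0 <= cmod u < 1 by rewrite cmod_ge0.
have q1 : 0 < 1 - cmod u by rewrite subr_gt0.
apply: (@le_of_pow_small _ _ _ (2 * (size s)%:R * cmod u / (1 - cmod u)) (cmod u)) => // M.
have pois x : x \in s -> (1 - cmod u ^+ 2) / cmod (1 - u * x) ^+ 2 <=
   1 + 2 * (\sum_(m < M) complex.Re ((u * x) ^+ m.+1)) +
   2 * (cmod u ^+ M.+1 / (1 - cmod u)).
  move=> xs; set y := u * x.
  have uy : cmod u = cmod y by rewrite /y cmodM (s1 _ xs) mulr1.
  have y1 : 0 < cmod (1 - y).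
    by apply: lt_le_trans (cmod_1B_ge _); rewrite -uy subr_gt0.
  have y0 : 1 - y != 0 by rewrite -cmod_gt0.
  have -> : (1 - cmod u ^+ 2) / cmod (1 - y) ^+ 2 = 1 + 2 * complex.Re (y / (1 - y)).
    rewrite uy Re_invM -cmod_sqr; move: y1; move: (y) => [a b] y1.
    have := cmod_sqr (1 - Complex a b); rewrite /= => e.
    rewrite [cmod (Complex a b) ^+ 2]cmod_sqr/=.
    apply: (mulIf (x := cmod (1 - Complex a b) ^+ 2)).
      by rewrite lt0r_neq0// exprn_gt0.
    have D0 : cmod (1 - Complex a b) ^+ 2 != 0 by rewrite lt0r_neq0// exprn_gt0.
    rewrite divfK// [RHS]mulrDl -[2 * _ * _]mulrA divfK// mul1r e.
    ring.
  have -> : y / (1 - y) = \sum_(m < M) y ^+ m.+1 + y ^+ M.+1 / (1 - y).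
    have -> : \sum_(m < M) y ^+ m.+1 = y * \sum_(m < M) y ^+ m.
      by rewrite mulr_sumr; apply: eq_bigr => m _; rewrite exprS.
    have -> : y ^+ M.+1 = y * (1 - (1 - y) * \sum_(m < M) y ^+ m).
      rewrite exprS; congr (_ * _).
      by rewrite -[1 - y]opprB mulNr -subrX1 opprK; ring.
    by field.
  rewrite ReD Re_sum mulrDr addrA lerD2l ler_wpM2l//.
  rewrite (le_trans (ler_norm _))// (le_trans (normRe_le_cmod _))//.
  rewrite cmodM cmodV cmodX uy ler_wpM2l ?exprn_ge0 ?cmod_ge0//.
  by rewrite lef_pV2 ?posrE// -?uy// uy cmod_1B_ge.
rewrite (le_trans (y := \sum_(x <- s) (1 +
     2 * (\sum_(m < M) complex.Re ((u * x) ^+ m.+1)) +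
      2 * (cmod u ^+ M.+1 / (1 - cmod u)))))//.
  by rewrite big_seq [leRHS]big_seq; apply: ler_sum.
rewrite !big_split/= !big_const_seq !count_predT !iter_addr_0 -mulr_sumr.
rewrite -!addrA lerD2l.
rewrite lerD//; last first.
  by rewrite -mulr_natl exprS le_eqVlt; apply/orP; left; apply/eqP; ring.
rewrite exchange_big/= mulr_sumr.
rewrite (le_trans (y := \sum_(m < M) 4 * H * (m.+1%:R * cmod u ^+ m)))//; last first.
  rewrite -mulr_sumr ler_wpM2l ?mulr_ge0//; exact: arith_geometric_le.
apply: ler_sum => m _; rewrite -Re_sum.
under eq_bigr do rewrite exprMn.
rewrite -mulr_sumr.
rewrite (le_trans (y := 2 * (cmod u ^+ m * (2 * m.+1%:R * H))))//; last first.
  by rewrite le_eqVlt; apply/orP; left; apply/eqP; ring.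
rewrite ler_wpM2l// (le_trans (ler_norm _))// (le_trans (normRe_le_cmod _))//.
rewrite cmodM cmodX ler_pM ?exprn_ge0 ?cmod_ge0//; last exact: SH.
by rewrite exprS ler_piMl ?exprn_ge0 ?cmod_ge0// ltW.
Qed.

(** * Smoothing the sawtooth function *)

Lemma argsub1_ray {R : realType} (t : R) (x : R[i]) :
  argsub1 ((t%:C)%C * x) = atan (t * complex.Im x / (1 - t * complex.Re x)).
Proof. by rewrite /argsub1 Re_scale Im_scale. Qed.

Lemma argsub1_bound {R : realType} (x : R[i]) : `|argsub1 x| <= pi / 2.
Proof. by rewrite ler_norml !ltW// ?atan_gtNpi2// atan_ltpi2. Qed.

(** Two applications of the mean value theorem, the second one being explicit: the
derivative of the argument is [b / D] with [D t = (t - a)^2 + b^2], and a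
difference of two values of it is bounded with the help of
[2 |b (a - t)| <= D t]. *)
Lemma atan_ray_second_difference {R : realType} (a b d m : R) :
  a ^+ 2 + b ^+ 2 = 1 -> a < 1 -> 0 < d <= 1 / 2 -> 0 < m ->
  (forall t : R, 1 - 2 * d <= t <= 1 -> m <= (1 - t * a) ^+ 2 + (t * b) ^+ 2) ->
  `|atan (1 * b / (1 - 1 * a)) - 2 * atan ((1 - d) * b / (1 - (1 - d) * a))
    + atan ((1 - 2 * d) * b / (1 - (1 - 2 * d) * a))| <= d ^+ 2 / m.
Proof.
move=> ab a1 /andP[d0 d1] m0 mD.
pose g t := atan (t * b / (1 - t * a)).
rewrite -/(g 1) -/(g (1 - d)) -/(g (1 - 2 * d)).
pose D t := (1 - t * a) ^+ 2 + (t * b) ^+ 2.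
have DE (t : R) : D t = (t - a) ^+ 2 + b ^+ 2.
  have -> : (t - a) ^+ 2 + b ^+ 2 = t ^+ 2 - 2 * t * a + (a ^+ 2 + b ^+ 2) by ring.
  have -> : D t = 1 - 2 * t * a + t ^+ 2 * (a ^+ 2 + b ^+ 2) by rewrite /D; ring.
  by rewrite ab; ring.
have dg (t : R) : 0 <= t <= 1 -> is_derive t 1 g (b / D t).
  move=> /andP[t0 t1]; apply: is_derive_atan_ray.
  have [->|tn1] := eqVneq t 1; first by rewrite mul1r subr_gt0.
  have t1' : t < 1 by rewrite lt_neqAle tn1.
  nra.
(* The second difference of [g] is a first difference of [h]. *)
pose h (t : R) := g (t + d) - g t.
have dh (t : R) : 1 - 2 * d <= t <= 1 - d -> is_derive t 1 h (b / D (t + d) - b / D t).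
  move=> /andP[t0 t1].
  have d1t : is_derive t 1 (fun t : R => t + d) 1.
    have := is_deriveD (is_derive_id t 1) (is_derive_cst d t 1).
    by move=> /is_derive_eq; apply; rewrite addr0.
  have dgd : is_derive (t + d) 1 g (b / D (t + d)) by apply: dg; lra.
  have := @is_derive1_comp _ g (fun t => t + d) t _ _ dgd d1t; rewrite mulr1 => dc.
  by apply: is_deriveB; apply: dg; lra.
have [|t||c /itvP cc] := @MVT_segment R h (fun t => b / D (t + d) - b / D t) (1 - 2 * d) (1 - d).
- lra.
- by move=> /itvP tt; apply: dh; rewrite !tt.
- apply: derivable_within_continuous => t /itvP tt; apply: ex_derive.
  by apply: dh; rewrite !tt.
have c0 : 1 - 2 * d <= c by rewrite cc.
have c1 : c <= 1 - d by rewrite cc.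
rewrite /h.
have -> : 1 - d + d = 1 by ring.
have -> : 1 - 2 * d + d = 1 - d by ring.
have -> : 1 - d - (1 - 2 * d) = d by ring.
move=> e.
have -> : g 1 - 2 * g (1 - d) + g (1 - 2 * d) =
  g 1 - g (1 - d) - (g (1 - d) - g (1 - 2 * d)) by ring.
rewrite e.
have D1 : m <= D (c + d) by apply: mD; lra.
have D2 : m <= D c by apply: mD; lra.
have D10 : 0 < D (c + d) by apply: lt_le_trans D1.
have D20 : 0 < D c by apply: lt_le_trans D2.
have -> : b / D (c + d) - b / D c =
   d * ((b * (a - c)) / D c / D (c + d) + (b * (a - (c + d))) / D (c + d) / D c).
  have e1 : D c - D (c + d) = d * ((a - c) + (a - (c + d))) by rewrite !DE; ring.
  have -> : b / D (c + d) - b / D c = b * (D c - D (c + d)) / D (c + d) / D c.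
    by field; rewrite !lt0r_neq0.
  by rewrite e1; field; rewrite !lt0r_neq0.
have bnd (t : R) : m <= D t -> `|b * (a - t) / D t| <= 1 / 2.
  move=> mt; have Dt0 : 0 < D t by apply: lt_le_trans mt.
  rewrite normrM normfV (gtr0_norm Dt0) ler_pdivrMr// DE ler_norml.
  have := sqr_ge0 (b - (a - t)); have := sqr_ge0 (b + (a - t)).
  by move=> *; apply/andP; split; nra.
have bnd2 (t u : R) : m <= D t -> m <= D u -> `|b * (a - t) / D t / D u| <= 1 / 2 * m^-1.
  move=> mt mu; have Du0 : 0 < D u by apply: lt_le_trans mu.
  rewrite normrM normfV (gtr0_norm Du0) ler_pM ?invr_ge0 ?(ltW Du0)//.
    exact: bnd.
  by rewrite lef_pV2 ?posrE.
have h1 := bnd2 _ _ D2 D1; have h2 := bnd2 _ _ D1 D2.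
rewrite mulrAC -expr2 normrM (ger0_norm (sqr_ge0 d)) ler_wpM2l ?sqr_ge0//.
by rewrite (le_trans (ler_normD _ _))//; lra.
Qed.

(** Away from the jump, [|1 - t x|] stays comparable to [|1 - (1 - d) x|] on the
radii concerned and the second difference of the argument in the radius is
O(d^2 / |1 - (1 - d) x|^2). Within distance [d] of the jump the right-hand side is
at least 8, and the left-hand side at most 4 times [pi / 2]. *)
Lemma sawtooth_smoothing {R : realType} (x : R[i]) (d : R) :
  cmod x = 1 -> 0 < d <= 1 / 2 ->
  `|argsub1 x - 2 * argsub1 ((1 - d)%:C%C * x) + argsub1 ((1 - 2 * d)%:C%C * x)|
  <= 32 * (d ^+ 2 / cmod (1 - (1 - d)%:C%C * x) ^+ 2).
Proof.
move=> x1 /andP[d0 d1].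
have [->|xn1] := eqVneq x 1.
  rewrite !mulr1 /argsub1 /= !mul0r atan0.
  by rewrite mulr0 subrr addr0 normr0 mulr_ge0// divr_ge0// ?sqr_ge0.
have ab := cmod_sqr x; rewrite x1 expr1n in ab; symmetry in ab.
set a := complex.Re x in ab; set b := complex.Im x in ab.
have a1 : a < 1.
  have : a <= 1 by rewrite -x1 (le_trans (ler_norm _))// normRe_le_cmod.
  rewrite le_eqVlt => /orP[/eqP a1|//].
  have b0 : b = 0 by apply/eqP; rewrite -sqrf_eq0; apply/eqP; rewrite a1 in ab; lra.
  by case/eqP: xn1; apply/eqP; rewrite eq_complex /= -/a -/b a1 b0 !eqxx.
pose D t := (1 - t * a) ^+ 2 + (t * b) ^+ 2.
have DE t : cmod (1 - t%:C%C * x) ^+ 2 = D t by rewrite -ray_cmod_sqr.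
rewrite DE.
have D0 t : D t = 1 - 2 * t * a + t ^+ 2.
  rewrite /D (_ : t ^+ 2 = t ^+ 2 * (a ^+ 2 + b ^+ 2)); last by rewrite ab mulr1.
  ring.
have Dpos : 0 < D (1 - d).
  rewrite -DE exprn_gt0// (lt_le_trans _ (cmod_1B_ge _))//.
  by rewrite cmodM x1 mulr1 cmod_nonneg_real; lra.
have [D1|D1] := ltP (D 1) (d ^+ 2).
  have hD : D (1 - d) <= 4 * d ^+ 2.
    move: D1; rewrite !D0 => D1; nra.
  rewrite (le_trans (y := 8))//; last first.
    by rewrite mulrA ler_pdivlMr//; lra.
  have := argsub1_bound x; have := argsub1_bound ((1 - d)%:C%C * x).
  have := argsub1_bound ((1 - 2 * d)%:C%C * x); have := @pihalf_lt2 R.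
  rewrite !ler_norml => ? /andP[? ?] /andP[? ?] /andP[? ?].
  by apply/andP; split; lra.
have D10 : 0 < D 1 by apply: lt_le_trans D1; rewrite exprn_gt0.
have := @atan_ray_second_difference R a b d (D 1 / 4) ab a1.
rewrite d0 d1 divr_gt0// => /(_ isT isT) /=.
have hD (t : R) : 1 - 2 * d <= t <= 1 -> D 1 / 4 <= (1 - t * a) ^+ 2 + (t * b) ^+ 2.
  move=> /andP[t0 t1]; rewrite -/(D t) !D0.
  have tt : 0 <= t by lra.
  have aN : -1 <= a by nra.
  have := sqr_ge0 (1 - t); have := sqr_ge0 t; nra.
move=> /(_ hD).
rewrite !argsub1_ray.
have -> : argsub1 x = atan (1 * b / (1 - 1 * a)) by rewrite !mul1r.
move=> /le_trans; apply.
have hD2 : D (1 - d) <= 2 * D 1 by rewrite !D0 in D1 *; nra.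
have d2 : 0 < d ^+ 2 by rewrite exprn_gt0.
rewrite [leRHS]mulrCA ler_pM2l//.
rewrite -[leLHS]mul1r ler_pdivrMr ?divr_gt0// mulrAC ler_pdivlMr//; lra.
Qed.

(** * The indicator of an arc *)

Lemma cisD {R : realType} (x y : R) : cis (x + y) = cis x * cis y.
Proof.
by rewrite /cis cosD sinD; congr Complex; rewrite addrC [cos x * _]mulrC [sin x * cos y]mulrC.
Qed.

Lemma cmod1_cis {R : realType} (z : R[i]) : cmod z = 1 ->
  exists2 t : R, - pi <= t <= pi & z = cis t.
Proof.
move=> z1; have := cmod_sqr z; rewrite z1 expr1n.
have := normRe_le_cmod z; rewrite z1.
case: z {z1} => a b /=; rewrite ler_norml => /andP[a0 a1] e.
have a01 : -1 <= a <= 1 by rewrite a0 a1.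
have aI : a \in `[(-1), 1] by rewrite in_itv.
have s : sin (acos a) = `|b|.
  by rewrite sin_acos// e (_ : _ - _ = b ^+ 2) ?sqrtr_sqr//; ring.
have h0 := acos_ge0 a01; have h1 := acos_lepi a01; have p0 := @pi_gt0 R.
have [b0|b0] := leP 0 b.
  exists (acos a); first by apply/andP; split; lra.
  by rewrite /cis acosK// s ger0_norm.
exists (- acos a); first by apply/andP; split; lra.
by rewrite /cis cosN sinN acosK// s ltr0_norm// opprK.
Qed.

Lemma argsub1_cis {R : realType} (t : R) : 0 < t < pi *+ 2 ->
  argsub1 (cis t) = (pi - t) / 2.
Proof.
move=> /andP[t0 t2]; rewrite /argsub1 /=.
have s0 : 0 < sin (t / 2).
  apply: sin_gt0_pi; rewrite divr_gt0//= ltr_pdivrMr//.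
  by rewrite mulr_natr.
have th : t = (t / 2) *+ 2 by rewrite mulr2n; lra.
have -> : sin t = 2 * (cos (t / 2) * sin (t / 2)).
  by rewrite {1}th sin_mulr2n mulr2n; ring.
have -> : 1 - cos t = 2 * sin (t / 2) ^+ 2.
  by rewrite {1}th cos_mulr2n cos2sin2 !mulr2n; ring.
rewrite -[RHS]tanK; last first.
  by rewrite in_itv/=; apply/andP; split; move: t2; rewrite mulr2n; lra.
congr atan; rewrite /tan.
have -> : (pi - t) / 2 = - (t / 2 - pi / 2) by ring.
rewrite sinN sinBpihalf cosN cosBpihalf opprK.
by field; rewrite lt0r_neq0.
Qed.

Lemma cis_period {R : realType} (t : R) : cis (t + pi *+ 2) = cis t.
Proof. by rewrite /cis sinD2pi cosD2pi. Qed.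

Lemma argsub1_cis_neg {R : realType} (t : R) : - (pi *+ 2) < t < 0 ->
  argsub1 (cis t) = (- pi - t) / 2.
Proof.
move=> /andP[t0 t2]; rewrite -cis_period argsub1_cis.
  by rewrite mulr2n; ring.
by rewrite mulr2n in t0 *; apply/andP; split; lra.
Qed.

(** With [z = cis t], both arguments are affine in [t] off their jumps at [-b] and
[b]; they jump by pi there, in opposite directions in the difference. The formula
fails exactly at the two endpoints. *)
Lemma arc_indicator {R : realType} (z : R[i]) (b : R) :
  cmod z = 1 -> 0 < b < pi -> complex.Re z != cos b ->
  (b + argsub1 (z * cis b) - argsub1 (z * cis (- b))) / pi
  = (cos b < complex.Re z)%R%:R.
Proof.
move=> z1 /andP[b0 bpi]; have p0 := @pi_gt0 R.
have [t /andP[t0 t1] ->] := cmod1_cis z1; rewrite /= -!cisD => tb.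
have bI : b \in `[0, pi] by rewrite in_itv/= !ltW.
have tI : `|t| \in `[0, pi] by rewrite in_itv/= normr_ge0/= ler_norml t0 t1.
rewrite -(cos_norm t) ltr_cos//.
have e2 : pi *+ 2 = pi + pi :> R by rewrite mulr2n.
have pn0 : (pi : R) != 0 by rewrite lt0r_neq0.
have [tb'|tb'|tb'] := ltgtP `|t| b; last by rewrite -cos_norm tb' eqxx in tb.
  move: tb'; rewrite ltr_norml => /andP[h0 h1].
  rewrite argsub1_cis ?argsub1_cis_neg ?e2; try by apply/andP; split; lra.
  by rewrite [X in X / _](_ : _ = pi) ?divff//; lra.
move: tb'; rewrite lter_normr => /orP[] h.
  rewrite !argsub1_cis ?e2; try by apply/andP; split; lra.
  by rewrite [X in X / _](_ : _ = 0) ?mul0r//; lra.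
rewrite !argsub1_cis_neg ?e2; try by apply/andP; split; lra.
by rewrite [X in X / _](_ : _ = 0) ?mul0r//; lra.
Qed.

Lemma cmod_sub1_sqr {R : realType} (z : R[i]) : cmod z = 1 ->
  cmod (z - 1) ^+ 2 = 2 - 2 * complex.Re z.
Proof.
move=> z1; have := cmod_sqr z; rewrite z1 expr1n cmod_sqr.
case: z z1 => a b _ /= e.
have -> : (a - 1) ^+ 2 + (b - 0) ^+ 2 = a ^+ 2 + b ^+ 2 + 1 - 2 * a by ring.
by rewrite -e; ring.
Qed.

Lemma cmod_1B_sqr {R : realType} (z : R[i]) : cmod z = 1 ->
  cmod (1 - z) ^+ 2 = 2 - 2 * complex.Re z.
Proof. by move=> z1; rewrite -cmodN opprB cmod_sub1_sqr. Qed.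

(** The product and the sum of the squared distances from [z] to the endpoints of
the arc: if the product is small, so is one of the distances, while the sum keeps
the other one large. *)
Lemma endpoints_sum_product {R : realType} (z : R[i]) (b : R) : cmod z = 1 ->
  let D1 := cmod (1 - z * cis b) ^+ 2 in
  let D2 := cmod (1 - z * cis (- b)) ^+ 2 in
  D1 * D2 = 4 * (complex.Re z - cos b) ^+ 2 /\
  D1 + D2 = 4 - 4 * (complex.Re z * cos b).
Proof.
move=> z1 D1 D2; rewrite /D1 /D2; have [t _ ->] := cmod1_cis z1; rewrite -!cisD.
rewrite !cmod_1B_sqr ?cmod_cis//= !cosD cosN sinN.
have e := cos2Dsin2 t; have e' := cos2Dsin2 b.
split; last by ring.
have -> : (2 - 2 * (cos t * cos b - sin t * sin b)) *
   (2 - 2 * (cos t * cos b - sin t * - sin b))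
   = 4 * ((1 - cos t * cos b) ^+ 2 - sin t ^+ 2 * sin b ^+ 2) by ring.
have -> : sin t ^+ 2 = 1 - cos t ^+ 2 by rewrite -e; ring.
have -> : sin b ^+ 2 = 1 - cos b ^+ 2 by rewrite -e'; ring.
ring.
Qed.

(** * The contribution of one zero *)

(** A Richardson extrapolation to the unit circle of the argument at the radii
[1 - d] and [1 - 2 d], which cancels the first-order term in [d]. *)
Definition smooth_arg {R : realType} (d : R) (x : R[i]) : R :=
  2 * argsub1 ((1 - d)%:C%C * x) - argsub1 ((1 - 2 * d)%:C%C * x).

(** Up to a factor of order [d], the Poisson kernel of the point at distance [d]
from the circle. *)
Definition smoothing_error {R : realType} (d : R) (x : R[i]) : R :=
  d ^+ 2 / cmod (1 - (1 - d)%:C%C * x) ^+ 2.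

Lemma smoothing_error_ge0 {R : realType} (d : R) (x : R[i]) :
  0 <= smoothing_error d x.
Proof. by rewrite divr_ge0 ?sqr_ge0. Qed.

Lemma smoothing_error_ge {R : realType} (d C : R) (x : R[i]) :
  cmod x = 1 -> 0 < d <= 1 / 2 -> cmod (1 - x) ^+ 2 <= C * d ^+ 2 -> 0 <= C ->
  (1 + C)^-1 <= smoothing_error d x.
Proof.
move=> x1 /andP[d0 d1] hC C0.
have e : cmod (1 - (1 - d)%:C%C * x) ^+ 2 = d ^+ 2 + (1 - d) * cmod (1 - x) ^+ 2.
  rewrite -ray_cmod_sqr cmod_1B_sqr//.
  have := cmod_sqr x; rewrite x1 expr1n; case: (x) => a b /= e.
  have -> : (1 - (1 - d) * a) ^+ 2 + ((1 - d) * b) ^+ 2 =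
    1 - 2 * (1 - d) * a + (1 - d) ^+ 2 * (a ^+ 2 + b ^+ 2) by ring.
  by rewrite -e; ring.
have d2 : 0 < d ^+ 2 by rewrite exprn_gt0.
have h0 := sqr_ge0 (cmod (1 - x)).
have h1 : (1 - d) * cmod (1 - x) ^+ 2 <= cmod (1 - x) ^+ 2 by rewrite ler_piMl//; lra.
rewrite /smoothing_error e.
have p : 0 < d ^+ 2 + (1 - d) * cmod (1 - x) ^+ 2.
  by rewrite ltr_wpDr// mulr_ge0//; lra.
rewrite ler_pdivlMr// mulrC ler_pdivrMr; last by lra.
by lra.
Qed.

(** The constant 25 comes from [4 * (5 / 2)^2]. *)
Lemma close_to_endpoint {R : realType} (z : R[i]) (b d : R) :
  cmod z = 1 -> 0 < sin b -> 0 < d -> `|complex.Re z - cos b| <= 5 / 2 * d ->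
  cmod (1 - z * cis b) ^+ 2 <= 25 / sin b ^+ 2 * d ^+ 2 \/
  cmod (1 - z * cis (- b)) ^+ 2 <= 25 / sin b ^+ 2 * d ^+ 2.
Proof.
move=> z1 s0 d0 near; have [] := endpoints_sum_product b z1.
set D1 := cmod _ ^+ 2; set D2 := cmod _ ^+ 2 => hP hS.
have D10 : 0 <= D1 by exact: sqr_ge0.
have D20 : 0 <= D2 by exact: sqr_ge0.
have s2 : 0 < sin b ^+ 2 by rewrite exprn_gt0.
have sc : sin b ^+ 2 = 1 - cos b ^+ 2 by rewrite -(cos2Dsin2 b); ring.
have P25 : D1 * D2 <= 25 * d ^+ 2.
  have := near; rewrite -(ler_pXn2r (n := 2))// ?nnegrE//; last by lra.
  by rewrite real_normK ?num_real// hP exprMn; lra.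
have S2 : 2 * sin b ^+ 2 <= D1 + D2.
  rewrite hS sc; have := normRe_le_cmod z; rewrite z1 ler_norml => /andP[a0 a1].
  have := cos_geN1 b; have := cos_le1 b => c1 c0.
  nra.
have fin (x y : R) : 0 <= x -> sin b ^+ 2 <= y -> x * y <= 25 * d ^+ 2 ->
    x <= 25 / sin b ^+ 2 * d ^+ 2.
  move=> x0 sy xy; rewrite mulrAC ler_pdivlMr//.
  by rewrite (le_trans _ xy)// ler_wpM2l.
have [h|h] := leP (sin b ^+ 2) D2; first by left; apply: fin h _.
by right; apply: (fin _ D1) => //; [lra|rewrite mulrC].
Qed.

Lemma radial_projection {R : realType} (Z : R[i]) : Z != 0 ->
  cmod (Z / (cmod Z)%:C%C) = 1 /\ cmod (Z - Z / (cmod Z)%:C%C) = `|cmod Z - 1|.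
Proof.
move=> Z0; have c0 : 0 < cmod Z by rewrite cmod_gt0.
have cz : cmod (Z / (cmod Z)%:C%C) = 1.
  by rewrite cmodM cmodV cmod_real gtr0_norm// divff ?lt0r_neq0.
split=> //.
have -> : Z - Z / (cmod Z)%:C%C = (cmod Z - 1)%:C%C * (Z / (cmod Z)%:C%C).
  rewrite rmorphB/= mulrBl mul1r mulrCA divff ?mulr1//.
  by rewrite -cmod_eq0 cmod_real normr_eq0 lt0r_neq0.
by rewrite cmodM cz mulr1 cmod_real.
Qed.

(** If the distance from [z] to 1 is not within [d] of the radius, then [Z] and
[z] are on the same side of the boundary and [arc_indicator] is exact. Otherwise
[z] is at distance O(d) from an endpoint of the arc, where one of the two smoothing
errors is bounded below. *)
Lemma near_circle_indicator {R : realType} (Z z : R[i]) (b d : R) :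
  cmod z = 1 -> cmod (Z - z) <= d -> 0 < b < pi -> 0 < d <= 1 / 2 ->
  `|(cmod (Z - 1) < 2 * sin (b / 2))%R%:R
    - (b + argsub1 (z * cis b) - argsub1 (z * cis (- b))) / pi|
  <= 3 * (1 + 25 / sin b ^+ 2) *
     (smoothing_error d (z * cis b) + smoothing_error d (z * cis (- b))).
Proof.
move=> z1 Zz /andP[b0 bpi] d01; have /andP[d0 d1] := d01.
have p0 := @pi_gt0 R; have s0 : 0 < sin b by apply: sin_gt0_pi; rewrite b0.
have s2 : 0 < sin b ^+ 2 by rewrite exprn_gt0.
have h25 : 0 <= 25 / sin b ^+ 2 by rewrite divr_ge0// ltW.
set r := 2 * sin (b / 2).
have r0 : 0 < r by rewrite mulr_gt0// sin_gt0_pi//; apply/andP; split; lra.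
have r2 : r <= 2 by have := sin_le1 (b / 2); rewrite /r; lra.
have rE : r ^+ 2 = 2 - 2 * cos b.
  have e : b = (b / 2) *+ 2 by rewrite mulr2n; lra.
  by rewrite {1}e cos_mulr2n cos2sin2 /r !mulr2n; ring.
set E1 := smoothing_error d _; set E2 := smoothing_error d _.
have E10 : 0 <= E1 by exact: smoothing_error_ge0.
have E20 : 0 <= E2 by exact: smoothing_error_ge0.
have zE := cmod_sub1_sqr z1.
set q := cmod (z - 1) in zE; have q0 : 0 <= q by exact: cmod_ge0.
have q2 : q <= 2.
  by rewrite (le_trans (cmodD _ _))// z1 cmodN cmod1; lra.
(* [far]: the boundary of the disc does not separate [Z] from [z]. *)
have [far|near] := ltP d `|q - r|.
  have hZ : cmod (Z - 1) <= q + d.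
    rewrite (_ : Z - 1 = (z - 1) + (Z - z)); last by ring.
    by rewrite (le_trans (cmodD _ _))// lerD2l.
  have hz : q <= cmod (Z - 1) + d.
    rewrite /q (_ : z - 1 = (Z - 1) + (- (Z - z))); last by ring.
    by rewrite (le_trans (cmodD _ _))// lerD2l cmodN.
  have [c1 c2] : (cmod (Z - 1) < r) = (cos b < complex.Re z) /\
      complex.Re z != cos b.
    move: far; rewrite lter_normr => /orP[far|far].
      have qr : r ^+ 2 < q ^+ 2 by rewrite ltrXn2r// ?nnegrE//; lra.
      split; last by apply/eqP => e; rewrite zE rE e ltxx in qr.
      have -> : cmod (Z - 1) < r = false by apply/negbTE; rewrite -leNgt; lra.
      by apply/esym/negbTE; rewrite -leNgt; rewrite zE rE in qr; lra.
    have qr : q ^+ 2 < r ^+ 2 by rewrite ltrXn2r// ?nnegrE//; lra.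
    split; last by apply/eqP => e; rewrite zE rE e ltxx in qr.
    have -> : cmod (Z - 1) < r by lra.
    by apply/esym; rewrite zE rE in qr; lra.
  rewrite arc_indicator// ?b0// c1 subrr normr0.
  by rewrite mulr_ge0 ?addr_ge0// mulr_ge0// addr_ge0.
have nb : `|complex.Re z - cos b| <= 5 / 2 * d.
  have -> : complex.Re z - cos b = - ((q - r) * (q + r)) / 2.
    have -> : (q - r) * (q + r) = q ^+ 2 - r ^+ 2 by ring.
    by rewrite zE rE; lra.
  rewrite normrM normrN normrM (ger0_norm (_ : 0 <= q + r)); last by lra.
  rewrite (@ger0_norm _ 2^-1)//.
  have := ler_pM (normr_ge0 _) (_ : 0 <= q + r) near (_ : q + r <= 4).
  by move=> /(_ ltac:(lra) ltac:(lra)); lra.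
have hE : 1 <= (1 + 25 / sin b ^+ 2) * (E1 + E2).
  rewrite mulrC -ler_pdivrMr; last by lra.
  rewrite mul1r.
  have cz c : cmod (z * cis c) = 1 by rewrite cmodM z1 cmod_cis mulr1.
  have [h|h] := close_to_endpoint z1 s0 d0 nb.
    by have := smoothing_error_ge (cz _) d01 h h25; rewrite -/E1; lra.
  by have := smoothing_error_ge (cz _) d01 h h25; rewrite -/E2; lra.
rewrite (le_trans (y := 3))//; last by rewrite -mulrA; lra.
have := argsub1_bound (z * cis b); have := argsub1_bound (z * cis (- b)).
rewrite !ler_norml => /andP[? ?] /andP[? ?].
set x := (_ / pi).
have x1 : -1 <= x by rewrite /x ler_pdivlMr//; lra.
have x2 : x <= 2 by rewrite /x ler_pdivrMr//; lra.
by case: (_ < _)%R; rewrite ?mulr1n ?mulr0n; apply/andP; split; lra.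
Qed.

(** Zeros far from the circle are paid for by the logarithms of their moduli. *)
Lemma ln_radius_ge {R : realType} (x d : R) : 0 < x -> 0 < d <= 1 / 2 ->
  d < `|x - 1| -> d / 2 <= `|ln x|.
Proof.
move=> x0 /andP[d0 d1]; rewrite lter_normr => /orP[h|h].
  have h1 : 1 < x by lra.
  rewrite (le_trans _ (ler_norm _))//.
  have := @le_ln1Dx R (x^-1 - 1).
  rewrite addrCA subrr addr0 lnV ?posrE// => /(_ _)-H.
  have xi : x^-1 <= (1 + d)^-1 by rewrite lef_pV2 ?posrE//; lra.
  have di : (1 + d)^-1 <= 1 - d / 2.
    by rewrite -[leLHS]mul1r ler_pdivrMr; [nra|lra].
  have xp : 0 < x^-1 by rewrite invr_gt0.
  have := H ltac:(lra); lra.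
rewrite ler_normr; apply/orP; right.
have := @le_ln1Dx R (x - 1).
rewrite addrCA subrr addr0 => /(_ ltac:(lra)); lra.
Qed.

(** The sum of a bound for the smoothing of the sawtooth and of the constant of
[near_circle_indicator]. *)
Definition zero_const {R : realType} (b : R) : R := 16 + 3 * (1 + 25 / sin b ^+ 2).

Lemma zero_indicator {R : realType} (Z : R[i]) (b d : R) :
  Z != 0 -> 0 < b < pi -> 0 < d <= 1 / 2 ->
  `|(cmod (Z - 1) < 2 * sin (b / 2))%R%:R
    - (b + smooth_arg d (Z / (cmod Z)%:C%C * cis b)
         - smooth_arg d (Z / (cmod Z)%:C%C * cis (- b))) / pi|
  <= zero_const b *
     (smoothing_error d (Z / (cmod Z)%:C%C * cis b) +
      smoothing_error d (Z / (cmod Z)%:C%C * cis (- b)))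
     + 10 / d * `|ln (cmod Z)|.
Proof.
move=> Z0 b01 d01; have /andP[d0 d1] := d01; have /andP[b0 bpi] := b01.
have p0 := @pi_gt0 R; have p2 := @pi_ge2 R.
have s2 : 0 < sin b ^+ 2 by rewrite exprn_gt0// sin_gt0_pi.
have h25 : 0 <= 25 / sin b ^+ 2 by rewrite divr_ge0// ltW.
have [z1 Zz] := radial_projection Z0; set z := Z / _ in z1 Zz *.
set x1 := z * cis b; set x2 := z * cis (- b).
set E1 := smoothing_error d x1; set E2 := smoothing_error d x2.
have E10 : 0 <= E1 by exact: smoothing_error_ge0.
have E20 : 0 <= E2 by exact: smoothing_error_ge0.
have cz c : cmod (z * cis c) = 1 by rewrite cmodM z1 cmod_cis mulr1.
set i := (cmod (Z - 1) < 2 * sin (b / 2))%R%:R.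
have l0 : 0 <= `|ln (cmod Z)| by [].
have [far|near] := ltP d `|cmod Z - 1|.
  have hl := ln_radius_ge (_ : 0 < cmod Z) d01 far.
  have {}hl : d / 2 <= `|ln (cmod Z)| by apply: hl; rewrite cmod_gt0.
  have h5 : 5 <= 10 / d * `|ln (cmod Z)| by rewrite mulrAC ler_pdivlMr//; lra.
  (* The indicator is at most 1, and the other term lies between -3 and 4. *)
  rewrite (le_trans (y := 5))//; last first.
    rewrite (le_trans h5)// lerDr mulr_ge0 ?addr_ge0// /zero_const; lra.
  have a1 := argsub1_bound ((1 - d)%:C%C * x1).
  have a2 := argsub1_bound ((1 - 2 * d)%:C%C * x1).
  have a3 := argsub1_bound ((1 - d)%:C%C * x2).
  have a4 := argsub1_bound ((1 - 2 * d)%:C%C * x2).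
  move: a1 a2 a3 a4; rewrite /smooth_arg.
  rewrite !ler_norml => /andP[? ?] /andP[? ?] /andP[? ?] /andP[? ?].
  set x := (_ / pi).
  have y1 : -3 <= x by rewrite /x ler_pdivlMr//; lra.
  have y2 : x <= 4 by rewrite /x ler_pdivrMr//; lra.
  by rewrite /i; case: (cmod (Z - 1) < _)%R; rewrite ?mulr1n ?mulr0n; apply/andP; split; lra.
have hn := near_circle_indicator z1 (_ : cmod (Z - z) <= d) b01 d01.
have {}hn := hn ltac:(by rewrite Zz).
rewrite -/x1 -/x2 -/E1 -/E2 -/i in hn.
have s1 : `|argsub1 x1 - smooth_arg d x1| <= 32 * E1.
  rewrite (_ : argsub1 x1 - smooth_arg d x1 = argsub1 x1 -
     2 * argsub1 ((1 - d)%:C%C * x1) + argsub1 ((1 - 2 * d)%:C%C * x1)); last first.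
    by rewrite /smooth_arg; ring.
  exact: (sawtooth_smoothing (cz b) d01).
have s2' : `|argsub1 x2 - smooth_arg d x2| <= 32 * E2.
  rewrite (_ : argsub1 x2 - smooth_arg d x2 = argsub1 x2 -
     2 * argsub1 ((1 - d)%:C%C * x2) + argsub1 ((1 - 2 * d)%:C%C * x2)); last first.
    by rewrite /smooth_arg; ring.
  exact: (sawtooth_smoothing (cz (- b)) d01).
set S1 := smooth_arg d x1 in s1 *; set S2 := smooth_arg d x2 in s2' *.
have -> : i - (b + S1 - S2) / pi = (i - (b + argsub1 x1 - argsub1 x2) / pi) +
   ((argsub1 x1 - S1) - (argsub1 x2 - S2)) / pi by ring.
rewrite (le_trans (ler_normD _ _))//.
have h3 : `|((argsub1 x1 - S1) - (argsub1 x2 - S2)) / pi| <= 16 * (E1 + E2).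
  rewrite normrM normfV (gtr0_norm p0) ler_pdivrMr//.
  rewrite (le_trans (ler_normB _ _))//.
  have : 16 * (E1 + E2) * 2 <= 16 * (E1 + E2) * pi by rewrite ler_wpM2l//; lra.
  lra.
have h4 : 0 <= 10 / d * `|ln (cmod Z)| by rewrite mulr_ge0// divr_ge0// ltW.
rewrite /zero_const; lra.
Qed.

(** * Mahler measure and radial projection of the zeros *)

Lemma cmod_reflect {R : realType} (x z : R[i]) : cmod x = 1 ->
  cmod (1 - (z^*)%C * x) = cmod (x - z).
Proof.
move=> x1; rewrite -[RHS]cmodJ rmorphB/= -[RHS]mul1r -x1 -cmodM mulrBr mulJ_cmod1//.
by rewrite mulrC.
Qed.

(** Replacing each factor [x - z] with [|z| < 1] by [1 - z^* x] does not change the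
modulus on the circle, and makes the constant coefficient equal in modulus to the
Mahler measure, so the bound on coefficients applies. *)
Lemma mahler_le {R : realType} (c : R[i]) (s : seq R[i]) (M : R) :
  (forall x, cmod x = 1 -> cmod (c * \prod_(z <- s) (x - z)) <= M) ->
  cmod c * \prod_(z <- s) Num.max 1 (cmod z) <= M.
Proof.
move=> cM.
pose f (z : R[i]) : {poly R[i]} :=
  if cmod z < 1 then 1 - ((z^*)%C)%:P * 'X else 'X - z%:P.
have := @coef_le_circle R (c *: \prod_(z <- s) f z) M.
move=> /(_ _ 0%N)-H; move: H; rewrite -horner_coef0 hornerZ horner_prod cmodM cmod_prod.
rewrite (eq_bigr (fun z => Num.max 1 (cmod z))).
  apply => x x1; rewrite hornerZ horner_prod.
  suff -> : cmod (c * \prod_(z <- s) (f z).[x]) = cmod (c * \prod_(z <- s) (x - z)).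
    exact: cM.
  rewrite !cmodM !cmod_prod; congr (_ * _); apply: eq_bigr => z _.
  rewrite /f; case: ifP => _; rewrite !hornerE//.
  exact: cmod_reflect.
move=> z _; rewrite /f; case: ltP => h; rewrite !hornerE.
  by rewrite ?mulr0 ?oppr0 ?addr0 cmod1.
by rewrite ?add0r cmodN.
Qed.

Lemma normr_ln {R : realType} (x : R) : 0 < x ->
  `|ln x| = 2 * ln (Num.max 1 x) - ln x.
Proof.
move=> x0; have [x1|x1] := leP 1 x.
  by rewrite ger0_norm ?ln_ge0//; ring.
by rewrite ln1 ltr0_norm ?mulr0 ?sub0r// ln_lt0// x0.
Qed.

(** Since [|ln x| = 2 * ln (max 1 x) - ln x], this follows from the bound on the
Mahler measure and from the value of the product of the zeros. *)
Lemma sum_ln_radius_le {R : realType} (c : R[i]) (s : seq R[i]) (M : R) :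
  c != 0 -> (forall z, z \in s -> z != 0) ->
  (forall x, cmod x = 1 -> cmod (c * \prod_(z <- s) (x - z)) <= M) ->
  \sum_(z <- s) `|ln (cmod z)| <=
    2 * (ln M - (ln (cmod c) + ln (cmod (c * \prod_(z <- s) z))) / 2).
Proof.
move=> c0 s0 cM; have hM := mahler_le cM.
have mpos : 0 < \prod_(z <- s) Num.max 1 (cmod z).
  by apply: prodr_gt0 => z _; rewrite lt_max ltr01.
have cpos : 0 < cmod c by rewrite cmod_gt0.
have spos z : z \in s -> 0 < cmod z by move=> zs; rewrite cmod_gt0 s0.
have ppos : 0 < \prod_(z <- s) cmod z by rewrite big_seq; apply: prodr_gt0.
have Mpos : 0 < M by apply: lt_le_trans hM; rewrite mulr_gt0.
have : ln (cmod c * \prod_(z <- s) Num.max 1 (cmod z)) <= ln M.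
  by rewrite ler_ln ?posrE// mulr_gt0.
rewrite cmodM cmod_prod !lnM ?posrE// !ln_prod//; last first.
  by move=> z _; rewrite lt_max ltr01.
have -> : \sum_(z <- s) `|ln (cmod z)| =
   2 * \sum_(z <- s) ln (Num.max 1 (cmod z)) - \sum_(z <- s) ln (cmod z).
  rewrite mulr_sumr -sumrB big_seq [RHS]big_seq; apply: eq_bigr => z zs.
  by rewrite normr_ln// spos.
lra.
Qed.

(** After rotation, with [t = |z|], the difference of the two sides is
[(1 - t)^2 >= 0]. *)
Lemma schur_radial {R : realType} (x z : R[i]) : cmod x = 1 -> z != 0 ->
  cmod z * cmod (1 - x * (z / (cmod z)%:C%C)) ^+ 2 <= cmod ((x^*)%C - z) ^+ 2.
Proof.
move=> x1 z0; have c0 : 0 < cmod z by rewrite cmod_gt0.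
have -> : cmod ((x^*)%C - z) = cmod (1 - x * z).
  by rewrite -(mulJ_cmod1 x1) -mulrBr cmodM x1 mul1r.
set t := cmod z in c0 *; set y := z / t%:C%C.
have y1 : cmod y = 1 by have [] := radial_projection z0.
have -> : x * z = t%:C%C * (x * y).
  by rewrite /y mulrCA mulrA [x * _]mulrC; field; rewrite -cmod_eq0 cmod_real normr_eq0 lt0r_neq0.
rewrite -ray_cmod_sqr cmod_1B_sqr; last by rewrite cmodM x1 y1 mulr1.
have := cmod_sqr (x * y); rewrite cmodM x1 y1 mulr1 expr1n.
case: (x * y) => a b /= e.
have -> : (1 - t * a) ^+ 2 + (t * b) ^+ 2 = 1 - 2 * t * a + t ^+ 2 * (a ^+ 2 + b ^+ 2) by ring.
rewrite -e; have := sqr_ge0 (1 - t); nra.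
Qed.

Lemma size_prod_linear {R : realType} (s : seq R[i]) (f : R[i] -> R[i]) :
  (size (\prod_(z <- s) (1 - 'X * (f z)%:P))%R <= (size s).+1)%N.
Proof.
elim: s => [|z s ih]; first by rewrite big_nil size_poly1.
rewrite big_cons (leq_trans (size_polyMleq _ _))//.
have h : (size (1 - 'X * (f z)%:P)%R <= 2)%N.
  rewrite (leq_trans (size_polyD _ _))// size_poly1 size_polyN geq_max/=.
  by rewrite (leq_trans (size_polyMleq _ _))// size_polyX/= size_polyC; case: (_ != _).
by move: h ih => /=; lia.
Qed.

(** Schur's inequality bounds the product on the circle, since
[cmod (c * prod z)] accounts for the product of the radii, and
[horner_le_circle] extends the bound to the disc. *)
Lemma angular_product_le {R : realType} (c : R[i]) (s : seq R[i]) (M : R) :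
  c != 0 -> (forall z, z \in s -> z != 0) ->
  (forall x, cmod x = 1 -> cmod (c * \prod_(z <- s) (x - z)) <= M) ->
  forall y, cmod y <= 1 ->
  cmod (\prod_(z <- s) (1 - y * (z / (cmod z)%:C%C))) <=
    expR (ln M - (ln (cmod c) + ln (cmod (c * \prod_(z <- s) z))) / 2
            + ln (size s).+1%:R).
Proof.
move=> c0 s0 cM y y1.
have mpos : 0 < \prod_(z <- s) Num.max 1 (cmod z).
  by apply: prodr_gt0 => z _; rewrite lt_max ltr01.
have cpos : 0 < cmod c by rewrite cmod_gt0.
have Mpos : 0 < M by apply: lt_le_trans (mahler_le cM); rewrite mulr_gt0.
have spos z : z \in s -> 0 < cmod z by move=> zs; rewrite cmod_gt0 s0.
have ppos : 0 < \prod_(z <- s) cmod z by rewrite big_seq; apply: prodr_gt0.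
pose p : {poly R[i]} := \prod_(z <- s) (1 - 'X * (z / (cmod z)%:C%C)%:P).
have pE x : p.[x] = \prod_(z <- s) (1 - x * (z / (cmod z)%:C%C)).
  by rewrite /p horner_prod; apply: eq_bigr => z _; rewrite !hornerE.
set L := ln M - _.
rewrite expRD lnK ?posrE// mulrC -pE.
have circ x : cmod x = 1 -> cmod p.[x] <= expR L.
  move=> x1; rewrite -(ler_pXn2r (n := 2))// ?nnegrE ?cmod_ge0 ?expR_ge0//.
  have -> : expR L ^+ 2 = M ^+ 2 / (cmod c * cmod (c * \prod_(z <- s) z)).
    have cp : 0 < cmod (c * \prod_(z <- s) z) by rewrite cmodM cmod_prod mulr_gt0.
    rewrite -[RHS]lnK ?posrE ?divr_gt0 ?exprn_gt0 ?mulr_gt0//.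
    rewrite -expRM_natl lnM ?posrE ?exprn_gt0 ?invr_gt0 ?mulr_gt0//.
    rewrite lnV ?posrE ?mulr_gt0// lnM ?posrE// lnXn//.
    by congr expR; rewrite /L -[in RHS](mulr_natl (ln M)); lra.
  rewrite ler_pdivlMr; last by rewrite mulr_gt0// cmodM cmod_prod mulr_gt0.
  have h := cM (x^*)%C; rewrite cmodJ in h; have {h} := h x1.
  rewrite -(ler_pXn2r (n := 2))// ?nnegrE ?cmod_ge0 ?(ltW Mpos)//; apply: le_trans.
  rewrite pE !cmodM !cmod_prod exprMn -!prodrXl.
  rewrite [X in X <= _](_ : _ = cmod c ^+ 2 * \prod_(z <- s) (cmod z *
     cmod (1 - x * (z / (cmod z)%:C%C)) ^+ 2)); last first.
    by rewrite [in RHS]big_split/= !prodrXl; ring.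
  rewrite ler_pM2l ?exprn_gt0//.
  rewrite big_seq [leRHS]big_seq; apply: ler_prod => z zs.
  by rewrite mulr_ge0 ?cmod_ge0 ?sqr_ge0//= schur_radial// s0.
rewrite (le_trans (horner_le_circle circ y1))//.
by rewrite ler_wpM2r ?expR_ge0// ler_nat size_prod_linear.
Qed.

(** * Counting the zeros in a disc *)

Lemma zerosP {R : realType} (p : {poly R[i]}) : p != 0 ->
  p = lead_coef p *: \prod_(z <- zeros p) ('X - z%:P).
Proof.
by move=> p0; rewrite /zeros (negbTE p0); case: closed_field_poly_normal.
Qed.

Lemma size_zeros {R : realType} (p : {poly R[i]}) : p != 0 ->
  (size (zeros p)).+1 = size p.
Proof.
move=> p0; rewrite [in RHS](zerosP p0) size_scale ?lead_coef_eq0//.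
by rewrite size_prod_XsubC.
Qed.

(** From [disc_count_normalized]: each of the two smoothing errors sums to at most
[n d + 4 H / d], the two smoothed arguments contribute [5 H / d] and the zeros far
from the circle [20 H / d]. *)
Definition arc_const {R : realType} (b : R) : R := 8 * zero_const b + 25.

Lemma zero_const_ge0 {R : realType} (b : R) : 0 <= zero_const b.
Proof.
by rewrite /zero_const addr_ge0// mulr_ge0// addr_ge0// divr_ge0// sqr_ge0.
Qed.

(** Summing [zero_indicator] over the zeros. The rotation by [w] and by the
endpoints of the arc is moved into the base point [u t a], so that one bound on the
power sums of the projected zeros serves all the sums. *)
Lemma disc_count_normalized {R : realType} (c w : R[i]) (s : seq R[i]) (M b d : R) :
  c != 0 -> (forall z, z \in s -> z != 0) ->
  (forall x, cmod x = 1 -> cmod (c * \prod_(z <- s) (x - z)) <= M) ->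
  cmod w = 1 -> 0 < b < pi -> 0 < d <= 1 / 2 ->
  `|\sum_(z <- s) \1_(disc w (2 * sin (b / 2))) z - b / pi * (size s)%:R|
  <= arc_const b * ((size s)%:R * d +
      (ln M - (ln (cmod c) + ln (cmod (c * \prod_(z <- s) z))) / 2
            + ln (size s).+1%:R) / d).
Proof.
move=> c0 s0 cM w1 b01 d01; have /andP[d0 d1] := d01.
have p0 := @pi_gt0 R; have p2 := @pi_ge2 R.
have rad := sum_ln_radius_le c0 s0 cM.
have ang := angular_product_le c0 s0 cM.
set H0 := ln M - _ in rad ang *.
set N := (size s)%:R : R.
have H00 : 0 <= H0.
  suff : 0 <= 2 * H0 by lra.
  by apply: le_trans rad; apply: sumr_ge0.
have lN0 : 0 <= ln (size s).+1%:R :> R by rewrite ln_ge0// ler1n.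
set H := H0 + _ in ang *.
have HH : 0 <= H by rewrite addr_ge0.
have H0H : H0 <= H by rewrite lerDl.
pose xi (z : R[i]) := z / (cmod z)%:C%C.
pose s' := [seq xi z | z <- s].
have s'1 x : x \in s' -> cmod x = 1.
  by case/mapP => z /s0 z0 ->; have [] := radial_projection z0.
have S' k : (0 < k)%N -> cmod (\sum_(x <- s') x ^+ k) <= 2 * k%:R * H.
  apply: power_sum_le => // z z1; rewrite big_map; apply: ang; exact: ltW.
have N' : (size s')%:R = N by rewrite size_map.
have w0 : w != 0 by rewrite -cmod_eq0 w1 oner_eq0.
pose u (t : R) (a : R) : R[i] := t%:C%C * (w^-1 * cis a).
have cu t a : 0 <= t -> cmod (u t a) = t.
  by move=> t0; rewrite !cmodM cmod_nonneg_real// cmodV w1 cmod_cis invr1 !mulr1.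
pose L a z := smooth_arg d (w^-1 * cis a * xi z).
pose E a z := smoothing_error d (w^-1 * cis a * xi z).
have sumL a : `|\sum_(z <- s) L a z| <= 5 * H / d.
  rewrite /L /smooth_arg sumrB -mulr_sumr.
  have h1 := @sum_argsub1_le _ _ _ (u (1 - d) a) s'1 S' HH.
  have h2 := @sum_argsub1_le _ _ _ (u (1 - 2 * d) a) s'1 S' HH.
  rewrite !cu in h1 h2; try lra.
  have {}h1 := h1 ltac:(lra); have {}h2 := h2 ltac:(lra).
  rewrite !big_map in h1 h2.
  under eq_bigr do rewrite mulrA.
  under [X in _ - X]eq_bigr do rewrite mulrA.
  rewrite (le_trans (ler_normB _ _))// normrM (ger0_norm (ler0n _ 2)).
  have e1 : 2 * H / (1 - (1 - d)) = 2 * H / d by congr (_ / _); ring.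
  have e2 : 2 * H / (1 - (1 - 2 * d)) = H / d.
    by rewrite (_ : 1 - (1 - 2 * d) = 2 * d); [field; rewrite lt0r_neq0|ring].
  by rewrite e1 in h1; rewrite e2 in h2; lra.
have sumE a : \sum_(z <- s) E a z <= N * d + 4 * H / d.
  have h1 := @sum_poisson_le _ _ _ (u (1 - d) a) s'1 S' HH.
  rewrite cu in h1; last by lra.
  have {}h1 := h1 ltac:(lra); rewrite big_map N' in h1.
  rewrite -mulr_sumr in h1.
  rewrite /E /smoothing_error -mulr_sumr.
  under eq_bigr do rewrite mulrA.
  set S := \sum_(z <- s) _ in h1 *.
  have Sge0 : 0 <= S.
    by apply: sumr_ge0 => z _; rewrite invr_ge0 sqr_ge0.
  have e1 : 1 - (1 - d) = d by ring.
  rewrite e1 in h1.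
  have h2 : d * S <= N + 4 * H / d ^+ 2.
    apply: le_trans h1; apply: ler_wpM2r => //; nra.
  have -> : N * d + 4 * H / d = d * (N + 4 * H / d ^+ 2).
    by field; rewrite lt0r_neq0.
  by rewrite expr2 -mulrA ler_pM2l.
have term z : z \in s -> `|\1_(disc w (2 * sin (b / 2))) z
      - (b + L b z - L (- b) z) / pi| <=
    zero_const b * (E b z + E (- b) z) + 10 / d * `|ln (cmod z)|.
  move=> zs; have z0 := s0 _ zs.
  have zw0 : z / w != 0 by rewrite mulf_neq0// invr_neq0.
  have := zero_indicator zw0 b01 d01.
  have cw : cmod (z / w) = cmod z by rewrite cmodM cmodV w1 invr1 mulr1.
  have ez a : z / w / (cmod (z / w))%:C%C * cis a = w^-1 * cis a * xi z.
    by rewrite cw /xi; ring.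
  rewrite !ez cw -/(L _ _) -/(E _ _).
  have -> : (cmod (z / w - 1) < 2 * sin (b / 2))%R%:R =
     \1_(disc w (2 * sin (b / 2))) z :> R.
    rewrite indicE; congr (_%:R); congr nat_of_bool.
    have -> : cmod (z / w - 1) = cmod (z - w).
      have -> : z - w = (z / w - 1) * w by rewrite mulrBl divfK// mul1r.
      by rewrite cmodM w1 mulr1.
    apply/idP/idP => [h|]; [by rewrite inE|by rewrite inE].
  done.
have -> : \sum_(z <- s) \1_(disc w (2 * sin (b / 2))) z - b / pi * N =
  \sum_(z <- s) (\1_(disc w (2 * sin (b / 2))) z - (b + L b z - L (- b) z) / pi)
  + (\sum_(z <- s) L b z - \sum_(z <- s) L (- b) z) / pi.
  rewrite sumrB -mulr_suml sumrB big_split/= big_const_seq count_predT iter_addr_0.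
  rewrite -[b *+ _]mulr_natr -/N.
  by ring.
rewrite (le_trans (ler_normD _ _))//.
have A2 : `|(\sum_(z <- s) L b z - \sum_(z <- s) L (- b) z) / pi| <= 5 * H / d.
  rewrite normrM normfV (gtr0_norm p0) ler_pdivrMr//.
  rewrite (le_trans (ler_normB _ _))//.
  have := sumL b; have := sumL (- b).
  have q0 : 0 <= 5 * H / d by rewrite divr_ge0// ?mulr_ge0// ltW.
  have : 5 * H / d * 2 <= 5 * H / d * pi by rewrite ler_wpM2l.
  lra.
have A1 : `|\sum_(z <- s) (\1_(disc w (2 * sin (b / 2))) z
     - (b + L b z - L (- b) z) / pi)| <=
    zero_const b * (2 * (N * d + 4 * H / d)) + 20 * H / d.
  rewrite (le_trans (ler_norm_sum _ _ _))//.
  rewrite (le_trans (y := \sum_(z <- s) (zero_const b * (E b z + E (- b) z) +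
       10 / d * `|ln (cmod z)|)))//.
    by rewrite big_seq [leRHS]big_seq; apply: ler_sum.
  rewrite big_split/= -!mulr_sumr big_split/=; apply: lerD.
    rewrite ler_wpM2l ?zero_const_ge0//.
    by have := sumE b; have := sumE (- b); lra.
  by rewrite mulrAC ler_wpM2r ?invr_ge0 ?(ltW d0)//; lra.
rewrite (le_trans (lerD A1 A2))// /arc_const.
have Nd : 0 <= N * d by rewrite mulr_ge0// ltW.
have Hd : 0 <= H / d by rewrite divr_ge0// ltW.
have := mulr_ge0 (zero_const_ge0 b) Nd; have := mulr_ge0 (zero_const_ge0 b) Hd.
rewrite -!(mulrA _ H); set X := H / d in Hd *; set Y := N * d in Nd *.
by set C := zero_const b; nra.
Qed.

Lemma disc_count {R : realType} (p : {poly R[i]}) (n : nat) (w : R[i]) (M b d : R) :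
  size p = n.+1 -> p`_0 != 0 ->
  (forall x, cmod x = 1 -> cmod p.[x] <= M) ->
  cmod w = 1 -> 0 < b < pi -> 0 < d <= 1 / 2 ->
  `|\sum_(z <- zeros p) \1_(disc w (2 * sin (b / 2))) z - b / pi * n%:R|
  <= arc_const b * (n%:R * d +
      (ln M - (ln (cmod p`_n) + ln (cmod p`_0)) / 2 + ln n.+1%:R) / d).
Proof.
move=> sp p00 pM w1 b01 d01.
have p0 : p != 0 by rewrite -size_poly_eq0 sp.
have sz : size (zeros p) = n by apply: succn_inj; rewrite size_zeros.
have pE x : p.[x] = p`_n * \prod_(z <- zeros p) (x - z).
  rewrite {1}(zerosP p0) hornerZ lead_coefE sp horner_prod.
  by congr (_ * _); apply: eq_bigr => z _; rewrite !hornerE.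
have pn0 : p`_n != 0 by rewrite -[n]/(n.+1.-1) -sp -lead_coefE lead_coef_eq0.
have P0 : p`_0 = p`_n * \prod_(z <- zeros p) (0 - z) by rewrite -horner_coef0 pE.
have z0 z : z \in zeros p -> z != 0.
  move=> zp; apply: contra p00 => /eqP z0; rewrite P0 (big_rem z)//= z0 subrr mul0r.
  by rewrite mulr0.
have := @disc_count_normalized _ p`_n w (zeros p) M b d pn0 z0 _ w1 b01 d01.
rewrite sz; have -> : cmod (p`_n * \prod_(z <- zeros p) z) = cmod p`_0.
  rewrite P0 !cmodM !cmod_prod; congr (_ * _); apply: eq_bigr => z _.
  by rewrite sub0r cmodN.
apply => x x1; rewrite -pE; exact: pM.
Qed.

(** * Integrals of possibly non-measurable functions *)

(** This monotonicity holds beyond measurable functions, because the integral of a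
nonnegative function is a supremum over the simple functions below it. *)
Lemma le_integral_ge0 d (T : measurableType d) (R : realType)
  (mu : {measure set T -> \bar R}) (f g : T -> \bar R) :
  (forall x, 0 <= f x)%E -> (forall x, f x <= g x)%E ->
  (\int[mu]_x f x <= \int[mu]_x g x)%E.
Proof.
move=> f0 fg; rewrite !ge0_integralTE//; last by move=> x; apply: le_trans (fg x).
apply: le_ereal_sup => _ /= [h hf <-]; exists h => // x.
exact: le_trans (hf x) (fg x).
Qed.

(** The upper bound is monotonicity. For the lower one, [E] cannot be moved to the
other side of [m <= N + E] under the integral of [N], so monotonicity is applied to
the positive part of [m - E], which is measurable and below [N]. *)
Lemma integral_within d (T : measurableType d) (R : realType) (P : probability T R)
    (N : T -> R) (E : T -> \bar R) (m e : R) :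
  (forall x, 0 <= N x) -> 0 <= m -> (forall x, 0 <= E x)%E ->
  measurable_fun [set: T] E ->
  (forall x, (N x)%:E <= m%:E + E x)%E -> (forall x, m%:E <= (N x)%:E + E x)%E ->
  (\int[P]_x E x <= e%:E)%E ->
  exists v : R, (\int[P]_x (N x)%:E = v%:E)%E /\ `|v - m| <= e.
Proof.
move=> N0 m0 E0 mE up lo Ee.
have icst : (\int[P]_x m%:E = m%:E)%E.
  rewrite (integral_cst P measurableT m%:E) -[RHS]mule1; congr (_ * _)%E; exact: probability_setT.
have I1 : (\int[P]_x (N x)%:E <= (m + e)%:E)%E.
  rewrite (le_trans (le_integral_ge0 P _ up))//.
  rewrite ge0_integralD// EFinD.
  by rewrite icst leeD2l.
have I0 : (0 <= \int[P]_x (N x)%:E)%E.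
  by apply: integral_ge0 => x _; rewrite lee_fin.
have I2 : (m%:E <= \int[P]_x (N x)%:E + e%:E)%E.
  pose g x := maxe (m%:E - E x)%E 0%E.
  have mg : measurable_fun [set: T] g.
    by apply: measurable_maxe => //; exact: emeasurable_funB.
  have g0 x : (0 <= g x)%E by rewrite /g le_max lexx orbT.
  have gN x : (g x <= (N x)%:E)%E.
    rewrite /g ge_max lee_fin N0 andbT.
    move: (lo x) (E0 x); case: (E x) => [s| |]//=; last by rewrite leNye.
    by rewrite -EFinB -EFinD !lee_fin lerBlDr.
  have mgE x : (m%:E <= g x + E x)%E.
    have := E0 x; case Ex : (E x) => [s| |]// s0; last first.
      by rewrite addey ?leey// -ltNye (lt_le_trans _ (g0 x))// ltNye.
    rewrite /g Ex -EFinB -EFin_max -EFinD lee_fin.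
    by case: (leP (m - s) 0); lra.
  rewrite -[leLHS]icst (le_trans (le_integral_ge0 P _ mgE))//.
  rewrite ge0_integralD//; apply: leeD => //.
  exact: le_integral_ge0.
move: I0 I1 I2; case: (\int[P]_x (N x)%:E)%E => [v| |]//= _.
rewrite -EFinD !lee_fin => h1 h2; exists v; split => //.
by rewrite ler_norml; apply/andP; split; lra.
Qed.

Lemma measurable_cmod d (T : measurableType d) (R : realType) (X : T -> R[i]) :
  complex_random_variable X -> measurable_fun [set: T] (fun x => cmod (X x)).
Proof.
move=> [mr mi].
rewrite (_ : (fun x => cmod (X x)) = Num.sqrt \o
  (fun x => complex.Re (X x) ^+ 2 + complex.Im (X x) ^+ 2)); last first.
  by apply/funext => x /=; rewrite /cmod; case: (X x).
apply: measurableT_comp; first by apply: continuous_measurable_fun; exact: sqrt_continuous.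
by apply: measurable_funD; apply: measurable_funX.
Qed.

Lemma measurable_lne_cmod d (T : measurableType d) (R : realType) (a : T -> R) :
  (forall x, 0 <= a x) -> measurable_fun [set: T] a ->
  measurable_fun [set: T] (fun x => lne (a x)%:E).
Proof.
move=> a0 ma.
rewrite (_ : (fun x => lne (a x)%:E) =
  (fun x => if a x == 0 then -oo%E else (ln (a x))%:E)); last first.
  apply/funext => x; case: eqVneq => [->|ax]; first by rewrite le0_lneNy.
  by rewrite lne_EFin// lt_def ax a0.
apply: measurable_fun_ifT => //.
  by apply: measurable_fun_eqr.
by apply/measurable_EFinP; apply: measurableT_comp => //; exact: measurable_ln.
Qed.

(** * Expected number of zeros *)

Lemma ln_le_powR {R : realType} (a t : R) : 0 <= a -> 0 < t -> ln a <= a `^ t / t.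
Proof.
move=> a0 t0; have [a1|a1] := leP a 0.
  by rewrite ln0// divr_ge0 ?powR_ge0// ltW.
rewrite ler_pdivlMr// mulrC -ln_powR.
have p0 : 0 < a `^ t by rewrite powR_gt0.
have := @le_ln1Dx R (a `^ t - 1); rewrite addrCA subrr addr0 => H.
have := H ltac:(lra); lra.
Qed.

(** With [S] the sum of the [a k `^ t], each [a k] is at most [S `^ t^-1], and
[ln S] is at most [ln n.+1 + S / n.+1]. Being linear in [S], the bound can be
integrated without Jensen's inequality, and it holds for [t] on both sides of 1. *)
Lemma ln_sum_le {R : realType} (n : nat) (a : nat -> R) (t : R) :
  (forall k, 0 <= a k) -> 0 < a 0%N -> 0 < t ->
  ln (\sum_(k < n.+1) a k) <=
    (1 + t^-1) * ln n.+1%:R + (\sum_(k < n.+1) a k `^ t) / (t * n.+1%:R).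
Proof.
move=> a0 a00 t0; set S := \sum_(k < n.+1) a k `^ t.
have n0 : 0 < n.+1%:R :> R by rewrite ltr0n.
have S0 : 0 < S.
  rewrite /S big_ord_recl/= ltr_wpDr ?powR_gt0// sumr_ge0// => k _; exact: powR_ge0.
have aS k : (k < n.+1)%N -> a k <= S `^ t^-1.
  move=> kn.
  have -> : a k = (a k `^ t) `^ t^-1.
    by rewrite -powRrM divff ?lt0r_neq0// powRr1.
  apply: ge0_ler_powR; rewrite ?nnegrE ?invr_ge0 ?powR_ge0 ?(ltW t0) ?(ltW S0)//.
  rewrite /S (bigD1 (Ordinal kn))//= lerDl sumr_ge0// => j _; exact: powR_ge0.
have M0 : 0 < \sum_(k < n.+1) a k.
  by rewrite big_ord_recl/= ltr_wpDr// sumr_ge0.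
have hM : \sum_(k < n.+1) a k <= n.+1%:R * S `^ t^-1.
  rewrite mulr_natl -[X in _ *+ X]card_ord -sumr_const.
  by apply: ler_sum => k _; exact: aS.
have : ln (\sum_(k < n.+1) a k) <= ln (n.+1%:R * S `^ t^-1).
  by rewrite ler_ln ?posrE// mulr_gt0// powR_gt0.
rewrite lnM ?posrE ?powR_gt0// ln_powR => h.
have hS : ln S <= ln n.+1%:R + S / n.+1%:R.
  have -> : S = n.+1%:R * (S / n.+1%:R) by rewrite mulrC divfK// lt0r_neq0.
  rewrite lnM ?posrE ?divr_gt0// [X in _ <= _ + X](_ : _ = S / n.+1%:R).
    rewrite lerD2l; have := @ln_le_powR R (S / n.+1%:R) 1.
    by rewrite powRr1 ?divr_ge0 ?(ltW S0)// divr1; apply.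
  by rewrite [_ * (_ / _)]mulrC divfK// lt0r_neq0.
have h2 : t^-1 * ln S <= t^-1 * (ln n.+1%:R + S / n.+1%:R).
  by rewrite ler_wpM2l// invr_ge0 ltW.
have -> : S / (t * n.+1%:R) = t^-1 * (S / n.+1%:R) by rewrite invfM; ring.
by rewrite (le_trans h)// mulrDl mul1r -addrA lerD2l -mulrDr.
Qed.

(** The moment bounds the integral of the positive part of the logarithm, since
[ln a <= a `^ t / t]; a lower bound on the whole integral then controls the negative
part. *)
Lemma integral_neg_lne_le d (T : measurableType d) (R : realType)
    (P : probability T R) (a : T -> R) (t B c : R) :
  (forall x, 0 <= a x) -> measurable_fun [set: T] a -> 0 < t ->
  (\int[P]_x (a x `^ t)%:E <= B%:E)%E ->
  (c%:E <= \int[P]_x lne (a x)%:E)%E ->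
  (\int[P]_x ((fun x => lne (a x)%:E)^\- x) <= (B / t - c)%:E)%E.
Proof.
move=> a0 ma t0 hB; rewrite integralE.
set Ip := (\int[P]_x _^\+ x)%E; set Im := (\int[P]_x _^\- x)%E.
have Im0 : (0 <= Im)%E by apply: integral_ge0 => x _; exact: funeneg_ge0.
have Ip0 : (0 <= Ip)%E by apply: integral_ge0 => x _; exact: funepos_ge0.
have IpB : (Ip <= (B / t)%:E)%E.
  have hx x : ((fun x => lne (a x)%:E)^\+ x <= t^-1%:E * (a x `^ t)%:E)%E.
    rewrite funeposE ge_max; apply/andP; split; last first.
      by rewrite -EFinM lee_fin mulr_ge0 ?powR_ge0// invr_ge0 ltW.
    have [ax|ax] := leP (a x) 0; first by rewrite le0_lneNy ?leNye// lee_fin.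
    by rewrite lne_EFin// -EFinM lee_fin mulrC; exact: ln_le_powR.
  rewrite (le_trans (le_integral_ge0 P _ hx))//.
  rewrite ge0_integralZl_EFin//; last 3 first.
  - by move=> x _; rewrite lee_fin powR_ge0.
  - apply/measurable_EFinP.
    by apply: (measurableT_comp (f := fun y => y `^ t)) => //; exact: measurable_powR.
  - by rewrite invr_ge0 ltW.
  by rewrite mulrC EFinM; apply: lee_wpmul2l => //; rewrite lee_fin invr_ge0 ltW.
move: Ip0 IpB Im0; case: Ip => [p| |]//; case: Im => [m| |]//=.
rewrite -EFinB !lee_fin => *; lra.
Qed.

Lemma arc_const_gt0 {R : realType} (b : R) : 0 < arc_const b.
Proof. by have := zero_const_ge0 b; rewrite /arc_const; lra. Qed.

(** The error bound is the sum of [E1], finite and linear in the moments, and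
[E2], which is infinite where an extreme coefficient vanishes. So the comparison
with [disc_count] holds at every sample point, and integrating the bounds shows
that the exceptional points do not matter. *)
Lemma expected_count d (T : measurableType d) (R : realType) (P : probability T R)
    (w : R[i]) (A : nat -> T -> R[i]) (n : nat) (b t B L dl : R) :
  (0 < n)%N -> (forall k, (k <= n)%N -> complex_random_variable (A k)) ->
  cmod w = 1 -> 0 < b < pi -> 0 < dl <= 1 / 2 -> 0 < t ->
  (forall k, (k <= n)%N -> (\int[P]_x (cmod (A k x) `^ t)%:E <= B%:E)%E) ->
  (forall k, k = 0%N \/ k = n ->
     (\int[P]_x ((fun x => lne (cmod (A k x))%:E)^\- x) <= L%:E)%E) ->
  exists v : R,
    (\int[P]_x (\sum_(z <- zeros (\poly_(k < n.+1) A k x))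
         \1_(disc w (2 * sin (b / 2))) z)%:E = v%:E)%E /\
    `|v - b / pi * n%:R| <= arc_const b *
       (n%:R * dl + ((2 + t^-1) * ln n.+1%:R + B / t + L) / dl).
Proof.
move=> n0 mA w1 b01 dl01 t0 hB hL; have /andP[dl0 dl1] := dl01.
have p0 := @pi_gt0 R; have /andP[b0 bpi] := b01.
have K0 := arc_const_gt0 b; set K := arc_const b in K0 *.
pose a k x := cmod (A k x).
have a0 k x : 0 <= a k x by exact: cmod_ge0.
have ma k : (k <= n)%N -> measurable_fun [set: T] (a k).
  by move=> kn; apply: measurable_cmod; exact: mA.
have map k : (k <= n)%N -> measurable_fun [set: T] (fun x => a k x `^ t).
  move=> kn; apply: (measurableT_comp (f := fun y => y `^ t)); last exact: ma.
  exact: measurable_powR.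
pose S x := \sum_(k < n.+1) a k x `^ t.
have S0 x : 0 <= S x by apply: sumr_ge0 => k _; exact: powR_ge0.
have mS : measurable_fun [set: T] S.
  apply: measurable_sum => k; apply: map; exact: (ltn_ord k).
pose ng k := (fun x => lne (a k x)%:E)^\-%E.
have mng k : (k <= n)%N -> measurable_fun [set: T] (ng k).
  move=> kn; apply: measurable_funeneg; apply: measurable_lne_cmod => //.
  exact: ma.
have ng0 k x : (0 <= ng k x)%E by exact: funeneg_ge0.
have l0 : 0 <= ln n.+1%:R :> R by rewrite ln_ge0// ler1n.
pose c1 := K * (n%:R * dl + (2 + t^-1) * ln n.+1%:R / dl).
pose c2 := K / (t * n.+1%:R * dl).
pose c3 := K / (2 * dl).
have c10 : 0 <= c1.
  rewrite /c1 mulr_ge0 ?(ltW K0)// addr_ge0 ?mulr_ge0 ?(ltW dl0)//.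
    by rewrite addr_ge0// invr_ge0 ltW.
  by rewrite invr_ge0 ltW.
have c20 : 0 <= c2 by rewrite divr_ge0 ?(ltW K0)// !mulr_ge0// ltW.
have c30 : 0 < c3 by rewrite divr_gt0// mulr_gt0.
pose E1 x := (c1%:E + c2%:E * (S x)%:E)%E.
pose E2 x := (c3%:E * (ng 0%N x + ng n x))%E.
have E10 x : (0 <= E1 x)%E by rewrite adde_ge0 ?mule_ge0 ?lee_fin.
have E20 x : (0 <= E2 x)%E by rewrite mule_ge0 ?adde_ge0// lee_fin ltW.
have mcS : measurable_fun [set: T] (fun x => c2%:E * (S x)%:E)%E.
  by apply: measurable_funeM; apply/measurable_EFinP.
have mE1 : measurable_fun [set: T] E1 by apply: emeasurable_funD.
have mng2 : measurable_fun [set: T] (fun x => ng 0%N x + ng n x)%E.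
  by apply: emeasurable_funD; exact: mng.
have mE2 : measurable_fun [set: T] E2 by apply: measurable_funeM.
pose N x := \sum_(z <- zeros (\poly_(k < n.+1) A k x)) \1_(disc w (2 * sin (b / 2))) z : R.
have N0 x : 0 <= N x.
  by apply: sumr_ge0 => z _; rewrite indicE.
have key x : (E1 x + E2 x = +oo)%E \/ exists2 e : R, (E1 x + E2 x = e%:E)%E &
   `|N x - b / pi * n%:R| <= e.
  have inf k : k = 0%N \/ k = n -> a k x = 0 -> (E1 x + E2 x = +oo)%E.
    move=> k0n ak; have ngk : (ng k x = +oo)%E.
      by rewrite /ng funenegE ak le0_lneNy//= /maxe ltNge leey.
    have E2k : (E2 x = +oo)%E.
      rewrite /E2; case: k0n => kE; rewrite kE in ngk; rewrite ngk.
        by rewrite addye ?gt0_muley ?lte_fin// -ltNye (lt_le_trans _ (ng0 _ x))// ltNye.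
      by rewrite addey ?gt0_muley ?lte_fin// -ltNye (lt_le_trans _ (ng0 _ x))// ltNye.
    by rewrite E2k addey// -ltNye (lt_le_trans _ (E10 x))// ltNye.
  have [a00|a00] := eqVneq (a 0%N x) 0; first by left; apply: (inf 0%N) => //; left.
  have [an0|an0] := eqVneq (a n x) 0; first by left; apply: (inf n) => //; right.
  right.
  have ngE k : a k x != 0 -> (ng k x = (Num.max (- ln (a k x)) 0)%:E)%E.
    move=> ak; rewrite /ng funenegE lne_EFin; last by rewrite lt_def ak a0.
    by rewrite -EFinN -EFin_max.
  rewrite /E1 /E2 !ngE// -!EFinM -!EFinD.
  eexists; first by [].
  pose p := \poly_(k < n.+1) A k x.
  have pc k : (k <= n)%N -> p`_k = A k x by move=> kn; rewrite coef_poly ltnS kn.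
  have sp : size p = n.+1.
    by rewrite size_poly_eq// -cmod_eq0.
  have p00 : p`_0 != 0 by rewrite pc// -cmod_eq0.
  have pM z : cmod z = 1 -> cmod p.[z] <= \sum_(k < n.+1) a k x.
    move=> z1; rewrite horner_poly (le_trans (cmod_sum _ _))//.
    by apply: ler_sum => k _; rewrite cmodM cmodX z1 expr1n mulr1.
  have := disc_count sp p00 pM w1 b01 dl01; rewrite !pc// -/(a _ _) -/(a _ _).
  move=> /le_trans; apply; rewrite -/K.
  have := @ln_sum_le R n (fun k => a k x) t (fun k => a0 k x) _ t0.
  have a00' : 0 < a 0%N x by rewrite lt_def a00 a0.
  move=> /(_ a00'); rewrite -/(S x).
  set M := ln (\sum_(k < n.+1) _) => hM.
  set u := Num.max (- ln (a 0%N x)) 0; set v := Num.max (- ln (a n x)) 0.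
  have hu : - ln (a 0%N x) <= u by rewrite le_max lexx.
  have hv : - ln (a n x) <= v by rewrite le_max lexx.
  have -> : c1 + c2 * S x + c3 * (u + v) = K * (n%:R * dl +
     ((1 + t^-1) * ln n.+1%:R + S x / (t * n.+1%:R) + (u + v) / 2 + ln n.+1%:R) / dl).
    rewrite /c1 /c2 /c3; field; rewrite !lt0r_neq0// ltr0n//.
  rewrite ler_wpM2l ?(ltW K0)// lerD2l ler_wpM2r ?invr_ge0 ?(ltW dl0)//.
  rewrite lerD2r; move: hM; set X := (_ + S x / _) => hM.
  by move: hM hu hv; clearbody X u v M; lra.
have m0 : 0 <= b / pi * n%:R by rewrite mulr_ge0// divr_ge0// ltW.
apply: (@integral_within _ _ _ P N (fun x => E1 x + E2 x)%E) => //.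
- by move=> x; rewrite adde_ge0.
- exact: emeasurable_funD.
- move=> x; have [->|[e -> he]] := key x; first by rewrite addey// leey.
  by rewrite -EFinD lee_fin; move: he; rewrite ler_norml; lra.
- move=> x; have [->|[e -> he]] := key x; first by rewrite addey// leey.
  by rewrite -EFinD lee_fin; move: he; rewrite ler_norml; lra.
rewrite ge0_integralD// ge0_integralD//; last first.
  by move=> x _; rewrite mule_ge0 ?lee_fin.
rewrite (integral_cst P measurableT c1%:E) ge0_integralZl_EFin//; last 2 first.
- by move=> x _; rewrite lee_fin.
- exact/measurable_EFinP.
rewrite ge0_integralZl_EFin//; last 2 first.
- by move=> x _; rewrite adde_ge0.
- exact: ltW.
rewrite ge0_integralD//; try exact: mng.
have IS : (\int[P]_x (S x)%:E <= (n.+1%:R * B)%:E)%E.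
  rewrite (_ : (fun x => (S x)%:E) = fun x => (\sum_(k < n.+1) (a k x `^ t)%:E)%E); last first.
    by apply/funext => x; rewrite /S sumEFin.
  rewrite ge0_integral_sum//; last 2 first.
  - by move=> k; apply/measurable_EFinP; apply: map; exact: (ltn_ord k).
  - by move=> k x _; rewrite lee_fin powR_ge0.
  rewrite (_ : (n.+1%:R * B)%:E = \sum_(k < n.+1) B%:E)%E; last first.
    by rewrite sumEFin sumr_const card_ord mulr_natl.
  by apply: lee_sum => k _; apply: hB; exact: (ltn_ord k).
have -> : (c1%:E * P [set: T] = c1%:E)%E.
  by rewrite -[RHS]mule1; congr (_ * _)%E; exact: probability_setT.
have -> : K * (n%:R * dl + ((2 + t^-1) * ln n.+1%:R + B / t + L) / dl) =
   c1 + c2 * (n.+1%:R * B) + c3 * (L + L).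
  by rewrite /c1 /c2 /c3; field; rewrite !lt0r_neq0// ltr0n.
rewrite !EFinD !EFinM; apply: leeD.
  by rewrite leeD2l// lee_wpmul2l// lee_fin.
rewrite lee_wpmul2l ?lee_fin ?(ltW c30)// EFinD.
by apply: leeD; apply: hL; [left|right].
Qed.

Lemma half_angle {R : realType} (r : R) : 0 < r -> r < 2 ->
  0 < 2 * asin (r / 2) < pi /\ 2 * sin (2 * asin (r / 2) / 2) = r.
Proof.
move=> r0 r2; have p0 := @pi_gt0 R.
have r1 : -1 <= r / 2 <= 1 by apply/andP; split; lra.
have sE : sin (asin (r / 2)) = r / 2 by rewrite asinK// in_itv.
have e : 2 * asin (r / 2) / 2 = asin (r / 2) by rewrite mulrAC divff// mul1r.
split; last by rewrite e sE; lra.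
have lt : asin (r / 2) < pi / 2 by apply: asin_ltpi2; apply/andP; split; lra.
have ge := asin_geNpi2 r1.
apply/andP; split; last by lra.
rewrite mulr_gt0// ltNge; apply/negP => le0.
have : 0 <= sin (- asin (r / 2)) by apply: sin_ge0_pi; apply/andP; split; lra.
by rewrite sinN sE; lra.
Qed.

(** The scale is [dl = q / (2 n)] with [q = sqrt (n ln (n + 1))]. Using
[n + 1] in the logarithm keeps [dl] positive at [n = 1]. *)
Lemma balance_scales {R : realType} (n : nat) (K C1 C2 : R) :
  (0 < n)%N -> 0 <= K -> 0 <= C1 -> 0 <= C2 ->
  let q := Num.sqrt (n%:R * ln n.+1%:R) in
  exists2 dl, 0 < dl <= 1 / 2 &
    K * (n%:R * dl + (C1 * ln n.+1%:R + C2) / dl) <=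
      K * (1 + 2 * C1 + 2 * C2 / ln 2) * q.
Proof.
move=> n0 K0 C10 C20 q; set l := ln n.+1%:R in q *.
have n0' : 0 < n%:R :> R by rewrite ltr0n.
have l2 : ln 2 <= l by rewrite ler_ln ?posrE ?ltr0n// ler_nat.
have ln20 : 0 < ln 2 :> R by rewrite ln_gt0// ltr1n.
have l0 : 0 < l by apply: lt_le_trans l2.
have l_n : l <= n%:R.
  by rewrite /l -natr1 addrC; apply: le_ln1Dx; rewrite (lt_le_trans (ltrN10 _)).
have q0 : 0 < q by rewrite sqrtr_gt0 mulr_gt0.
have q2 : q * q = n%:R * l by rewrite -expr2 sqr_sqrtr// mulr_ge0// ltW.
have qn : q <= n%:R.
  rewrite -(ler_pXn2r (n := 2))// ?nnegrE ?(ltW q0)// expr2 q2 expr2.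
  by rewrite ler_wpM2l.
exists (q / (2 * n%:R)).
  rewrite divr_gt0 ?mulr_gt0//= ler_pdivrMr ?mulr_gt0//; lra.
rewrite -mulrA ler_wpM2l//.
have -> : n%:R * (q / (2 * n%:R)) + (C1 * l + C2) / (q / (2 * n%:R)) =
   q / 2 + 2 * (C1 * (n%:R * l) + C2 * n%:R) / q.
  by field; rewrite !lt0r_neq0.
rewrite -q2.
have -> : 2 * (C1 * (q * q) + C2 * n%:R) / q = 2 * C1 * q + 2 * C2 * (n%:R / q).
  by field; rewrite lt0r_neq0.
have nq : n%:R / q <= q / ln 2.
  rewrite ler_pdivrMr// mulrAC q2 ler_pdivlMr// ler_wpM2l//.
have h : 2 * C2 * (n%:R / q) <= 2 * C2 * (q / ln 2) by rewrite ler_wpM2l// mulr_ge0.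
have -> : (1 + 2 * C1 + 2 * C2 / ln 2) * q = q + 2 * C1 * q + 2 * C2 * (q / ln 2) by ring.
lra.
Qed.

Lemma sqrt_ln_succ_le {R : realType} (n : nat) : (1 < n)%N ->
  Num.sqrt (n%:R * ln n.+1%:R) <= 2 * Num.sqrt (n%:R * ln n%:R) :> R.
Proof.
move=> n1; have nn : (0 < n)%N by lia.
have n0 : 0 < n%:R :> R by rewrite ltr0n.
have l0 : 0 <= ln n%:R :> R by rewrite ln_ge0// ler1n; lia.
have h : ln n.+1%:R <= 2 * ln n%:R :> R.
  rewrite mulr_natl -lnXn// ler_ln ?posrE ?exprn_gt0 ?ltr0n//.
  by rewrite -natrX ler_nat; nia.
have -> : 2 * Num.sqrt (n%:R * ln n%:R) = Num.sqrt (2 ^+ 2 * (n%:R * ln n%:R)) :> R.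
  by rewrite [RHS]sqrtrM ?sqr_ge0// sqrtr_sqr ger0_norm.
rewrite ler_wsqrtr//.
have := mulr_ge0 (ltW n0) l0; have := ler_wpM2l (ltW n0) h; lra.
Qed.

Theorem proposition2p5 (d : measure_display) (T : measurableType d)
    (R : realType) (P : probability T R)
    (w : R[i]) (r : R) (A : nat -> nat -> T -> R[i]) (t : R)
    (hw : unit_circle w) (hr0 : 0 < r) (hr2 : r < 2)
    (hA : forall n k : nat, (0 < n)%N -> (k <= n)%N ->
      complex_random_variable (A k n))
    (ht : 0 < t)
    (hsup : (ereal_sup [set y | exists n k : nat,
        [/\ (0 < n)%N, (k <= n)%N &
            y = 'E_P[fun x => (cmod (A k n x) `^ t)%R]]] < +oo)%E)
    (hinf : (-oo < ereal_inf [set y | exists n k : nat,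
        [/\ (0 < n)%N, k = 0%N \/ k = n &
            y = \int[P]_x lne (cmod (A k n x))%:E]])%E) :
  exists e : nat -> R,
    e =O_\oo (fun n : nat => Num.sqrt (n%:R * ln n%:R)) /\
    forall n : nat, (0 < n)%N ->
      ('E_P[fun x => (n%:R * zero_counting n (random_poly A n x) (disc w r))%R] =
      (2 * asin (r / 2) / pi * n%:R + e n)%R%:E)%E.
Proof.
have [b01 rE] := half_angle hr0 hr2; set b := 2 * asin (r / 2) in b01 rE *.
have [B B0 hB] : exists2 B : R, 0 <= B & forall n k, (0 < n)%N -> (k <= n)%N ->
    (\int[P]_x (cmod (A k n x) `^ t)%:E <= B%:E)%E.
  set s := ereal_sup _ in hsup.
  have sub n k : (0 < n)%N -> (k <= n)%N ->
      (\int[P]_x (cmod (A k n x) `^ t)%:E <= s)%E.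
    move=> n0 kn; apply: ereal_sup_ubound; exists n, k; split => //.
    by rewrite unlock.
  have s0 : (0 <= s)%E.
    apply: le_trans (sub 1%N 0%N isT isT).
    by apply: integral_ge0 => x _; rewrite lee_fin powR_ge0.
  move: s s0 sub hsup => [s| |]// s0 sub _; by exists s.
have [L L0 hL] : exists2 L : R, 0 <= L & forall n k, (0 < n)%N -> k = 0%N \/ k = n ->
    (\int[P]_x ((fun x => lne (cmod (A k n x))%:E)^\- x) <= L%:E)%E.
  set s := ereal_inf _ in hinf.
  have [c cs] : exists c : R, (c%:E <= s)%E.
    move: s hinf => [s| |]// _; first by exists s.
    by exists 0; rewrite leey.
  exists (B / t + `|c|); first by rewrite addr_ge0// divr_ge0// ltW.
  move=> n k n0 k0n; have kn : (k <= n)%N by case: k0n => ->.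
  rewrite (le_trans (y := (B / t - c)%:E))//; last first.
    by rewrite lee_fin lerD2l -normrN ler_norm.
  apply: integral_neg_lne_le => //.
  - by move=> x; exact: cmod_ge0.
  - by apply: measurable_cmod; exact: hA.
  - exact: hB.
  - by apply: (le_trans cs); apply: ereal_inf_lbound; exists n, k; split.
have t0 : 0 <= t^-1 by rewrite invr_ge0 ltW.
have C0 : 0 <= B / t + L by rewrite addr_ge0// divr_ge0// ltW.
pose K := arc_const b * (1 + 2 * (2 + t^-1) + 2 * (B / t + L) / ln 2).
pose Ez n :=
  ('E_P[fun x => (n%:R * zero_counting n (random_poly A n x) (disc w r))%R])%E.
have main n : (0 < n)%N -> exists2 v : R, Ez n = v%:E &
    `|v - b / pi * n%:R| <= K * Num.sqrt (n%:R * ln n.+1%:R).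
  move=> n0.
  have [|dl dl01 hdl] := @balance_scales R n (arc_const b) (2 + t^-1) (B / t + L)
    n0 (ltW (arc_const_gt0 b)) _ C0; first by rewrite addr_ge0.
  have [v [Ev hv]] := @expected_count d T R P w (fun k => A k n) n b t B L dl n0
    (fun k => hA n k n0) hw b01 dl01 ht (fun k => hB n k n0) (fun k => hL n k n0).
  exists v; last first.
    by rewrite addrA in hdl; exact: le_trans hv hdl.
  rewrite -Ev /Ez unlock; apply: eq_integral => x _; congr (_%:E).
  rewrite /zero_counting mulrA divff ?pnatr_eq0 -?lt0n// mul1r rE.
  by [].
exists (fun n => fine (Ez n) - b / pi * n%:R); split; last first.
  move=> n n0; have [v Ev _] := main n n0; rewrite -/(Ez n) Ev /=.
  by congr (_%:E); ring.
apply/eqOP; near=> k; near=> n.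
have n1 : (1 < n)%N by near: n; exact: nbhs_infty_gt.
have [v -> hv] := main n (ltnW n1); rewrite /= (le_trans hv)//.
have K0 : 0 <= K.
  have ln20 : 0 < ln 2 :> R by rewrite ln_gt0// ltr1n.
  rewrite /K mulr_ge0 ?(ltW (arc_const_gt0 b))// addr_ge0 ?divr_ge0 ?mulr_ge0 ?(ltW ln20)//.
  by rewrite addr_ge0// mulr_ge0// addr_ge0.
rewrite (le_trans (ler_wpM2l K0 (sqrt_ln_succ_le n1)))// mulrA.
rewrite ger0_norm ?sqrtr_ge0// ler_wpM2r ?sqrtr_ge0//.
Unshelve. all: by end_near. Qed.
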